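(* Let $\Gamma$ be a finite acyclic quiver having at least one arrow, let $\mathcal{A}=(A_i)_{i\in\Gamma_0}$ be a family of basic finite-dimensional algebras over an algebraically closed field $k$, and let $\Lambda = k(\Gamma,\mathcal{A})$ be the corresponding generalized path algebra. Then $$\operatorname{gl.dim} \Lambda = \max_{j\in\Gamma_0}\{1, \operatorname{gl.dim} A_j\}.$$
   Context: $k$ is an algebraically closed field. An algebra is an associative unitary basic finite-dimensional $k$-algebra and modules are finitely generated right modules. A quiver $\Gamma$ has vertex set $\Gamma_0$, arrow set $\Gamma_1$ (both finite), and each arrow $\beta$ goes from $s(\beta)$ to $e(\beta)$; paths are written left to right, so $\beta_1\cdots\beta_n$ is a path if $e(\beta_l)=s(\beta_{l+1})$ for all $l$. Generalized path algebra (gp-algebra): given an algebra $A_i$ for each $i\in\Gamma_0$, $k(\Gamma,\mathcal{A})$ is the $k$-vector space spanned by the $\mathcal{A}$-paths, i.e. the elements of the $A_i$ (length $0$) and the sequences $a_1\beta_1a_2\cdots a_n\beta_na_{n+1}$ with $\beta_1\cdots\beta_n$ a path in $\Gamma$ of length $n\ge 1$, $a_l\in A_{s(\beta_l)}$ for $l\le n$ and $a_{n+1}\in A_{e(\beta_n)}$, modulo $k$-linearity in each entry $a_l$ (in other words, it is the direct sum over all paths of $\Gamma$ of the tensor products over $k$ of the algebras at the successive vertices of the path). The multiplication is $$(a_1\beta_1\cdots\beta_na_{n+1})(b_1\gamma_1\cdots\gamma_mb_{m+1})=a_1\beta_1\cdots\beta_n(a_{n+1}b_1)\gamma_1\cdots\gamma_mb_{m+1}$$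 if the end vertex of the first $\mathcal{A}$-path equals the start vertex of the second, and $0$ otherwise. The identity is $\sum_{i\in\Gamma_0}1_{A_i}$. $\operatorname{gl.dim}$ denotes global dimension (possibly $\infty$). *)

(* Defs.v *)
From HB Require Import structures.
From mathcomp Require Import all_boot all_order all_algebra all_field.
From mathcomp Require Import boolp classical_sets constructive_ereal.
From mathcomp Require Import freeg.

Set Implicit Arguments.
Unset Strict Implicit.
Unset Printing Implicit Defensive.

Import Order.TTheory GRing.Theory.
Local Open Scope ring_scope.

Record quiver := Quiver {
  vertex : finType;
  arrow : finType;
  source : arrow -> vertex;
  target : arrow -> vertex
}.

(* A cyclic sequence of arrows is an oriented cycle of the quiver. *)
Definition acyclic (Q : quiver) : Prop :=
  forall p : seq (arrow Q),
    cycle (fun b c => target b == source c) p -> p = [::].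

Section APaths.
Variables (k : fieldType) (Q : quiver) (A : vertex Q -> falgType k).

(* [apath j i] is the type of the A-paths a_1 b_1 a_2 ... b_n a_(n+1) that   *)
(* start at i and end at j; paths compose from left to right.               *)
Inductive apath (j : vertex Q) : vertex Q -> Type :=
| APnil (a : A j) : apath j j
| APcons (b : arrow Q) (a : A (source b)) (p : apath j (target b)) :
    apath j (source b).

Definition apath_lmul j i (a : A i) (p : apath j i) : apath j i :=
  match p in apath _ i return A i -> apath j i with
  | APnil c => fun a => APnil (a * c)
  | APcons b c p => fun a => APcons (a * c) p
  end a.

Fixpoint apath_cat j i (p : apath j i) l (q : apath l j) : apath l i :=
  match p in apath _ i return apath l i with
  | APnil a => apath_lmul a q
  | APcons b a p => APcons a (apath_cat p q)
  end.

(* [apath_lin c p q r]: the three A-paths agree except in one entry, where   *)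
(* they have entries x, y and c x + y respectively.                         *)
Inductive apath_lin (c : k) (j : vertex Q) :
    forall i, apath j i -> apath j i -> apath j i -> Prop :=
| APlin_nil (x y : A j) :
    apath_lin c (APnil x) (APnil y) (APnil (c *: x + y))
| APlin_head b (x y : A (source b)) (p : apath j (target b)) :
    apath_lin c (APcons x p) (APcons y p) (APcons (c *: x + y) p)
| APlin_tail b (a : A (source b)) (p q r : apath j (target b)) :
    apath_lin c p q r ->
    apath_lin c (APcons a p) (APcons a q) (APcons a r).

Record any_apath := AnyAPath {
  ap_start : vertex Q;
  ap_end : vertex Q;
  ap_val :> apath ap_end ap_start
}.

HB.instance Definition _ := gen_eqMixin any_apath.
HB.instance Definition _ := gen_choiceMixin any_apath.

Local Notation V := {freeg any_apath / k}.

Definition ap_class j i (p : apath j i) : V := << AnyAPath p >>.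

Definition ap_mul (p q : any_apath) : V :=
  match ap_end p =P ap_start q with
  | ReflectT e =>
      ap_class (apath_cat p (ecast i (apath (ap_end q) i) (esym e) (ap_val q)))
  | ReflectF _ => 0
  end.

Definition free_mul (x y : V) : V :=
  fglift (fun p => fglift (ap_mul p) y) x.

Definition free_one : V := \sum_(i : vertex Q) ap_class (APnil (1 : A i)).

(* The subspace of V generated by the relations of k-linearity in each entry.*)
Definition multilin_rel : {pred V} := fun v => `[< forall D : V -> Prop,
  D 0 -> (forall c x y, D x -> D y -> D (c *: x + y)) ->
  (forall c j i (p q r : apath j i), apath_lin c p q r ->
     D (c *: ap_class p + ap_class q - ap_class r)) -> D v >].

Lemma fgliftD (M : lmodType k) (f : any_apath -> M) :
  {morph fglift f : x y / x + y}.
Proof.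
have fB := lift_is_additive f.
have f0 : fglift f 0 = 0 by rewrite -(subrr 0) fB subrr.
by move=> x y; rewrite -[y in LHS]opprK fB -[- y]sub0r fB f0 sub0r opprK.
Qed.

Lemma fglift0 (M : lmodType k) (f : any_apath -> M) : fglift f 0 = 0.
Proof. by apply: (addrI (fglift f 0)); rewrite -fgliftD !addr0. Qed.

Lemma fgliftZ (M : lmodType k) (f : any_apath -> M) c x :
  fglift f (c *: x) = c *: fglift f x.
Proof.
elim/freeg_ind_dom0: x => [|a p x _ _ IH]; first by rewrite scaler0 fglift0 scaler0.
rewrite scalerDr !fgliftD scalerDr IH; congr (_ + _).
have -> : c *: << a *g p >> = << (c * a) *g p >> :> V.
  by apply/eqP/freeg_eqP => y; rewrite coeffZ !coeffU mulrA.
by rewrite !liftU scalerA.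
Qed.

Lemma fglift_sum (M : lmodType k) (f : any_apath -> M) (I : finType) (F : I -> V) :
  fglift f (\sum_i F i) = \sum_i fglift f (F i).
Proof. exact: (big_morph _ (fgliftD f) (fglift0 f)). Qed.

Lemma fglift1 (M : lmodType k) (f : any_apath -> M) p :
  fglift f (<< p >> : V) = f p.
Proof. by rewrite liftU scale1r. Qed.

Lemma freeg_ind1 (D : V -> Prop) :
  D 0 -> (forall c x y, D x -> D y -> D (c *: x + y)) ->
  (forall p, D << p >>) -> forall x, D x.
Proof.
move=> D0 DL D1; elim/freeg_ind_dom0 => // a p x _ _ IH.
have -> : << a *g p >> = a *: << p >> :> V; last exact: DL.
by apply/eqP/freeg_eqP => y; rewrite coeffZ !coeffU mul1r.
Qed.

Lemma free_mulLl z c x y :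
  free_mul (c *: x + y) z = c *: free_mul x z + free_mul y z.
Proof. by rewrite /free_mul fgliftD fgliftZ. Qed.

Lemma free_mulLr z c x y :
  free_mul z (c *: x + y) = c *: free_mul z x + free_mul z y.
Proof.
elim/freeg_ind1: z => [|a z t Hz Ht|p].
- by rewrite /free_mul !fglift0 scaler0 addr0.
- rewrite !free_mulLl Hz Ht !scalerDr !scalerA [c * a]mulrC.
  by rewrite -!addrA; congr (_ + _); rewrite addrCA.
- by rewrite /free_mul !fglift1 fgliftD fgliftZ.
Qed.

Lemma free_mul0l x : free_mul 0 x = 0.
Proof. exact: fglift0. Qed.

Lemma free_mul0r x : free_mul x 0 = 0.
Proof.
have := free_mulLr x (-1) 0 0.
by rewrite scaler0 addr0 scaleN1r addNr.
Qed.

Lemma free_mulBl z x y : free_mul (x - y) z = free_mul x z - free_mul y z.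
Proof. by rewrite addrC -scaleN1r free_mulLl scaleN1r addrC. Qed.

Lemma free_mulBr z x y : free_mul z (x - y) = free_mul z x - free_mul z y.
Proof. by rewrite addrC -scaleN1r free_mulLr scaleN1r addrC. Qed.

Lemma free_mul11 p q : free_mul << p >> << q >> = ap_mul p q.
Proof. by rewrite /free_mul !fglift1. Qed.

Lemma ap_mulE j i (p : apath j i) l (q : apath l j) :
  ap_mul (AnyAPath p) (AnyAPath q) = ap_class (apath_cat p q).
Proof. by rewrite /ap_mul; case: eqP => //= e; rewrite eq_axiomK. Qed.

Lemma ap_mul0 p q : ap_end p != ap_start q -> ap_mul p q = 0.
Proof. by rewrite /ap_mul; case: eqP => // ->; rewrite eqxx. Qed.

Lemma apath_lmulA j i (a b : A i) (p : apath j i) :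
  apath_lmul a (apath_lmul b p) = apath_lmul (a * b) p.
Proof. by case: p a b => /= [c|b c p] a b'; rewrite mulrA. Qed.

Lemma apath_lmul1 j i (p : apath j i) : apath_lmul 1 p = p.
Proof. by case: p => *; rewrite /= mul1r. Qed.

Lemma apath_lmul_cat j i (a : A i) (p : apath j i) l (q : apath l j) :
  apath_cat (apath_lmul a p) q = apath_lmul a (apath_cat p q).
Proof. by case: p a => /= [c|b c p] a //; rewrite apath_lmulA. Qed.

Lemma apath_catA j i (p : apath j i) l (q : apath l j) m (r : apath m l) :
  apath_cat p (apath_cat q r) = apath_cat (apath_cat p q) r.
Proof. by elim: p => [a|b a p IH] /=; rewrite ?apath_lmul_cat ?IH. Qed.

Lemma apath_cat1 j i (p : apath j i) : apath_cat p (APnil 1) = p.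
Proof. by elim: p => [a|b a p IH] /=; rewrite ?mulr1 ?IH. Qed.

Lemma ap_mulA p q r :
  free_mul (ap_mul p q) << r >> = free_mul << p >> (ap_mul q r).
Proof.
have [e1|n1] := eqVneq (ap_end p) (ap_start q);
    have [e2|n2] := eqVneq (ap_end q) (ap_start r); last first.
- by rewrite !ap_mul0 // free_mul0l free_mul0r.
- rewrite (ap_mul0 n1) free_mul0l.
  case: p q r e2 n1 => [i j p] [j' l q] [l' m r] /= e; rewrite -{l'}e in r *.
  by move=> n; rewrite ap_mulE free_mul11 ap_mul0.
- rewrite (ap_mul0 n2) free_mul0r.
  case: p q r e1 n2 => [i j p] [j' l q] [l' m r] /= e; rewrite -{j'}e in q *.
  by move=> n; rewrite ap_mulE free_mul11 ap_mul0.
case: p q r e1 e2 => [i j p] [j' l q] [l' m r] /= e1 e2.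
rewrite -{j'}e1 -{l'}e2 in q r *.
by rewrite !ap_mulE !free_mul11 !ap_mulE apath_catA.
Qed.

Lemma free_mulA x y z :
  free_mul x (free_mul y z) = free_mul (free_mul x y) z.
Proof.
elim/freeg_ind1: x => [|c x x' Hx Hx'|p]; first by rewrite !free_mul0l.
  by rewrite !free_mulLl Hx Hx'.
elim/freeg_ind1: y => [|c y y' Hy Hy'|q].
- by rewrite !(free_mul0l, free_mul0r).
- by rewrite !(free_mulLl, free_mulLr) Hy Hy'.
elim/freeg_ind1: z => [|c z z' Hz Hz'|r]; first by rewrite !free_mul0r.
  by rewrite !free_mulLr Hz Hz'.
by rewrite !free_mul11 ap_mulA.
Qed.

Lemma free_mul1 : left_id free_one free_mul.
Proof.
elim/freeg_ind1 => [|c x y Hx Hy|[i j p]]; first exact: free_mul0r.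
  by rewrite free_mulLr Hx Hy.
rewrite /free_mul fglift_sum (bigD1 i) //= big1 => [|l nl].
  by rewrite addr0 !fglift1 ap_mulE /= apath_lmul1.
by rewrite !fglift1 ap_mul0.
Qed.

Lemma free_1mul : right_id free_one free_mul.
Proof.
elim/freeg_ind1 => [|c x y Hx Hy|[i j p]]; first exact: free_mul0l.
  by rewrite free_mulLl Hx Hy.
rewrite /free_mul fglift1 fglift_sum (bigD1 j) //= big1 => [|l nl].
  by rewrite addr0 !fglift1 ap_mulE /= apath_cat1.
by rewrite !fglift1 ap_mul0 //= eq_sym.
Qed.

Lemma multilin0 : 0 \in multilin_rel.
Proof. by rewrite unfold_in; apply/asboolP. Qed.

Lemma multilinL c x y :
  x \in multilin_rel -> y \in multilin_rel -> c *: x + y \in multilin_rel.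
Proof.
rewrite !unfold_in => /asboolP Hx /asboolP Hy; apply/asboolP => D D0 DL DR.
by apply: (DL); [apply: Hx|apply: Hy].
Qed.

Lemma multilin_gen c j i (p q r : apath j i) : apath_lin c p q r ->
  c *: ap_class p + ap_class q - ap_class r \in multilin_rel.
Proof. by move=> H; rewrite unfold_in; apply/asboolP => D _ _; apply. Qed.

Lemma multilin_zmod : zmod_closed multilin_rel.
Proof.
split=> [|x y Hx Hy]; first exact: multilin0.
by rewrite addrC -scaleN1r; apply: multilinL.
Qed.

HB.instance Definition _ := GRing.isZmodClosed.Build V multilin_rel multilin_zmod.

Lemma multilinZ c x : x \in multilin_rel -> c *: x \in multilin_rel.
Proof. by move=> Hx; rewrite -[_ *: _]addr0 multilinL ?multilin0. Qed.

Lemma apath_lin_lmul c j i (a : A i) (p q r : apath j i) :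
  apath_lin c p q r ->
  apath_lin c (apath_lmul a p) (apath_lmul a q) (apath_lmul a r).
Proof.
move=> H; case: H a => /= [x y|b x y t|b d x y z H] a.
- by rewrite mulrDr -scalerAr; constructor.
- by rewrite mulrDr -scalerAr; constructor.
- by constructor.
Qed.

Lemma apath_lin_catr c j i (t : apath j i) l (p q r : apath l j) :
  apath_lin c p q r ->
  apath_lin c (apath_cat t p) (apath_cat t q) (apath_cat t r).
Proof.
elim: t p q r => [a|b a t IH] p q r H /=; first exact: apath_lin_lmul.
by apply: APlin_tail; apply: IH.
Qed.

Lemma apath_lin_catl c j i (p q r : apath j i) l (t : apath l j) :
  apath_lin c p q r ->
  apath_lin c (apath_cat p t) (apath_cat q t) (apath_cat r t).
Proof.
elim=> [x y|b x y p'|b a p' q' r' _ IH] /=; [|by constructor..].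
by case: t x y => [a|b a t] x y; rewrite /= mulrDl -scalerAl; constructor.
Qed.

Lemma multilin_mulr z x : x \in multilin_rel -> free_mul z x \in multilin_rel.
Proof.
rewrite {1}unfold_in => /asboolP Hx.
apply: (Hx (fun x => free_mul z x \in multilin_rel)).
- by rewrite free_mul0r multilin0.
- by move=> c y t Hy Ht; rewrite free_mulLr multilinL.
move=> c j i p q r H; elim/freeg_ind1: z => [|d z z' Hz Hz'|[i' j' t]].
- by rewrite free_mul0l multilin0.
- by rewrite free_mulLl multilinL.
rewrite addrC -scaleN1r !free_mulLr !free_mul11 scaleN1r addrC.
have [e|n] := eqVneq j' i; last first.
  by rewrite !ap_mul0 // scaler0 subr0 addr0 multilin0.
rewrite {j'}e in t *; rewrite !ap_mulE.
exact/multilin_gen/apath_lin_catr.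
Qed.

Lemma multilin_mull z x : x \in multilin_rel -> free_mul x z \in multilin_rel.
Proof.
rewrite {1}unfold_in => /asboolP Hx.
apply: (Hx (fun x => free_mul x z \in multilin_rel)).
- by rewrite free_mul0l multilin0.
- by move=> c y t Hy Ht; rewrite free_mulLl multilinL.
move=> c j i p q r H; elim/freeg_ind1: z => [|d z z' Hz Hz'|[i' j' t]].
- by rewrite free_mul0r multilin0.
- by rewrite free_mulLr multilinL.
rewrite addrC -scaleN1r !free_mulLl !free_mul11 scaleN1r addrC.
have [e|n] := eqVneq j i'; last first.
  by rewrite !ap_mul0 // scaler0 subr0 addr0 multilin0.
rewrite -{i'}e in t *; rewrite !ap_mulE.
exact/multilin_gen/apath_lin_catl.
Qed.

Definition gp_algebra : Type := Quotient.quot multilin_rel.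

HB.instance Definition _ := GRing.Zmodule.on gp_algebra.

Definition gp_class (x : V) : gp_algebra := \pi_(Quotient.quot multilin_rel)%qT x.

Lemma gp_class_eqE x y : (gp_class x == gp_class y) = (x - y \in multilin_rel).
Proof. exact: esym (Quotient.idealrBE multilin_rel x y). Qed.

Lemma gp_classP x y : x - y \in multilin_rel -> gp_class x = gp_class y.
Proof. by move=> H; apply/eqP; rewrite gp_class_eqE. Qed.

Definition gp_repr (u : gp_algebra) : V := repr (u : Quotient.quot multilin_rel).

Lemma gp_reprK : cancel gp_repr gp_class.
Proof. exact: reprK. Qed.

Lemma gp_repr_class x : gp_repr (gp_class x) - x \in multilin_rel.
Proof. by rewrite -gp_class_eqE gp_reprK. Qed.

Lemma gp_classB : additive gp_class.
Proof. exact: (raddfB (\pi_(Quotient.quot multilin_rel)%qT)). Qed.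

HB.instance Definition _ := GRing.isZmodMorphism.Build V gp_algebra gp_class gp_classB.

Definition gp_mul (u v : gp_algebra) : gp_algebra :=
  gp_class (free_mul (gp_repr u) (gp_repr v)).

Lemma gp_class_mul x y : gp_mul (gp_class x) (gp_class y) = gp_class (free_mul x y).
Proof.
apply: gp_classP; set x' := gp_repr _; set y' := gp_repr _.
have Hx : x' - x \in multilin_rel := gp_repr_class x.
have Hy : y' - y \in multilin_rel := gp_repr_class y.
have := rpredD (multilin_mull y' Hx) (multilin_mulr x Hy).
by rewrite free_mulBl free_mulBr addrA addrNK.
Qed.

Lemma gp_mulA : associative gp_mul.
Proof.
move=> u v w; rewrite -[u]gp_reprK -[v]gp_reprK -[w]gp_reprK.
by rewrite !gp_class_mul free_mulA.
Qed.

Definition gp_one : gp_algebra := gp_class free_one.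

Lemma gp_mul1l : left_id gp_one gp_mul.
Proof. by move=> u; rewrite -[u]gp_reprK gp_class_mul free_mul1. Qed.

Lemma gp_mul1r : right_id gp_one gp_mul.
Proof. by move=> u; rewrite -[u]gp_reprK gp_class_mul free_1mul. Qed.

Lemma gp_mulDl : left_distributive gp_mul +%R.
Proof.
move=> u v w; rewrite -[u]gp_reprK -[v]gp_reprK -[w]gp_reprK.
rewrite -raddfD !gp_class_mul -raddfD /=.
by rewrite -[gp_repr u in LHS]scale1r free_mulLl scale1r.
Qed.

Lemma gp_mulDr : right_distributive gp_mul +%R.
Proof.
move=> u v w; rewrite -[u]gp_reprK -[v]gp_reprK -[w]gp_reprK.
rewrite -raddfD !gp_class_mul -raddfD /=.
by rewrite -[gp_repr v in LHS]scale1r free_mulLr scale1r.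
Qed.

(* Without vertices the generalized path algebra is the zero ring, so the    *)
(* construction only provides a possibly trivial ring.                      *)
HB.instance Definition _ := GRing.Zmodule_isPzRing.Build gp_algebra
  gp_mulA gp_mul1l gp_mul1r gp_mulDl gp_mulDr.

Definition gp_scale (c : k) (u : gp_algebra) : gp_algebra :=
  gp_class (c *: gp_repr u).

Lemma gp_class_scale c x : gp_scale c (gp_class x) = gp_class (c *: x).
Proof.
by apply: gp_classP; rewrite -scalerBr; apply: multilinZ (gp_repr_class x).
Qed.

Lemma gp_scaleA a b u : gp_scale a (gp_scale b u) = gp_scale (a * b) u.
Proof. by rewrite -[u]gp_reprK !gp_class_scale scalerA. Qed.

Lemma gp_scale1 : left_id 1 gp_scale.
Proof. by move=> u; rewrite -[u]gp_reprK gp_class_scale scale1r. Qed.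

Lemma gp_scaleDr : right_distributive gp_scale +%R.
Proof.
move=> c u v; rewrite -[u]gp_reprK -[v]gp_reprK.
by rewrite -raddfD !gp_class_scale -raddfD scalerDr.
Qed.

Lemma gp_scaleDl u : {morph gp_scale^~ u : a b / a + b}.
Proof.
by move=> a b; rewrite -[u]gp_reprK !gp_class_scale -raddfD scalerDl.
Qed.

HB.instance Definition _ := GRing.Zmodule_isLmodule.Build k gp_algebra
  gp_scaleA gp_scale1 gp_scaleDr gp_scaleDl.

Lemma gp_scaleAl c (u v : gp_algebra) : c *: (u * v) = c *: u * v.
Proof.
rewrite -[u]gp_reprK -[v]gp_reprK /GRing.scale /GRing.mul /=.
rewrite !(gp_class_mul, gp_class_scale).
by rewrite -[c *: gp_repr u]addr0 free_mulLl free_mul0l addr0.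
Qed.

Lemma gp_scaleAr c (u v : gp_algebra) : c *: (u * v) = u * (c *: v).
Proof.
rewrite -[u]gp_reprK -[v]gp_reprK /GRing.scale /GRing.mul /=.
rewrite !(gp_class_mul, gp_class_scale).
by rewrite -[c *: gp_repr v]addr0 free_mulLr free_mul0r addr0.
Qed.

Definition gp_path j i (p : apath j i) : gp_algebra := gp_class (ap_class p).

Lemma gp_path_lin c j i (p q r : apath j i) :
  apath_lin c p q r -> gp_path r = c *: gp_path p + gp_path q.
Proof.
move=> H; apply/esym/eqP; rewrite -subr_eq0 /gp_path.
rewrite [c *: _]gp_class_scale -raddfD -raddfB /= -(raddf0 gp_class).
by rewrite gp_class_eqE subr0 multilin_gen.
Qed.

Lemma gp_path_mul j i (p : apath j i) l (q : apath l j) :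
  gp_path p * gp_path q = gp_path (apath_cat p q).
Proof.
by rewrite /gp_path [_ * _]gp_class_mul /ap_class free_mul11 ap_mulE.
Qed.

Lemma gp_path_mul0 j i (p : apath j i) j' i' (q : apath j' i') :
  j != i' -> gp_path p * gp_path q = 0.
Proof.
move=> n; rewrite /gp_path [_ * _]gp_class_mul /ap_class free_mul11.
by rewrite ap_mul0 // raddf0.
Qed.

Lemma gp_path1 : 1 = \sum_(i : vertex Q) gp_path (APnil (1 : A i)).
Proof. by rewrite -raddf_sum. Qed.

End APaths.

(* A right R-module is a left module over the converse ring: m.a is (a *: m).*)
Notation rmodType R := (lmodType R^c).

Section HomologicalDimensions.
Variable R : pzRingType.

Definition fin_generated (M : rmodType R) : Prop :=
  exists s : seq M, forall x : M,
    exists c : 'I_(size s) -> R^c, x = \sum_i c i *: s`_i.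

Definition projective (P : rmodType R) : Prop :=
  forall (M N : rmodType R) (g : {linear M -> N}) (f : {linear P -> N}),
    (forall y, exists x, g x = y) ->
    exists h : {linear P -> M}, forall x, g (h x) = f x.

Definition proj_resolution (M : rmodType R) (P : nat -> rmodType R)
    (d : forall i, {linear P i.+1 -> P i}) (eps : {linear P 0%N -> M}) : Prop :=
  [/\ forall i, fin_generated (P i) /\ projective (P i),
      forall y, exists x, eps x = y,
      forall x, eps x = 0 <-> exists y, d 0%N y = x
    & forall i x, d i x = 0 <-> exists y, d i.+1 y = x].

Definition proj_resolution_length_le (M : rmodType R) (n : nat) : Prop :=
  exists P d eps, @proj_resolution M P d eps /\
    forall i, (n < i)%N -> forall x : P i, x = 0.

(* Dimensions are natural numbers or +oo, seen in the extended integers.     *)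
Definition projdim (M : rmodType R) : \bar int :=
  infimum +oo%E [set n%:Z%:E | n in proj_resolution_length_le M]%classic.

Definition gldim : \bar int :=
  supremum 0%E [set x | exists2 M, fin_generated M & x = projdim M]%classic.

End HomologicalDimensions.

Section Basic.
Variable R : pzRingType.

Definition primitive_idempotent (e : R) : Prop :=
  [/\ e * e = e, e <> 0 &
      forall f g : R, f * f = f -> g * g = g -> f * g = 0 -> g * f = 0 ->
        e = f + g -> f = 0 \/ g = 0].

(* u and v are mutually inverse right R-linear maps between eR and fR; their  *)
(* values outside these right ideals are irrelevant.                         *)
Definition idem_iso (e f : R) : Prop :=
  exists u v : R -> R,
    [/\ forall x, range ( *%R e) x -> range ( *%R f) (u x) /\ v (u x) = x,
        forall y, range ( *%R f) y -> range ( *%R e) (v y) /\ u (v y) = y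
      & forall a x y, range ( *%R e) x -> range ( *%R e) y ->
          u (x * a + y) = u x * a + u y].

Definition basic : Prop :=
  exists (n : nat) (e : 'I_n -> R),
    [/\ forall i, primitive_idempotent (e i),
        forall i j, i <> j -> e i * e j = 0,
        \sum_i e i = 1
      & forall i j, i <> j -> ~ idem_iso (e i) (e j)].

End Basic.

(* Main.v *)
(* Write L for the generalized path algebra, e_i for the identity of A_i and
   X e_i for the A_i-module cut out of an L-module X.

   If P is projective over L, then every k-linear twist of the arrow actions
   of an extension of P splits (lemma [twisted_lift]). This has two
   consequences. First, P e_i is projective over A_i. Secondly, a submodule Y
   of a finitely generated projective F is projective as soon as every Y e_i
   is: lift a map from Y vertex by vertex; the failure of the lift to commute
   with the arrows is a k-linear datum on Y, which extends to F because k is a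
   field and is then removed by a twist over F.

   Hence for n > 0 an n-th syzygy of X is projective over L exactly when all
   its parts at the vertices are, and by Schanuel's lemma pd X <= n follows
   from pd X e_i <= n for all i. Conversely cutting out the part at j maps a
   resolution over L of an A_j-module, put at the vertex j with zero arrows, to
   a resolution over A_j. Finally a twist along an arrow b shows that
   A_(source b), with zero arrows, is not projective. *)

Require Import Defs.
From HB Require Import structures.
From mathcomp Require Import all_boot all_order all_algebra all_field.
From mathcomp Require Import boolp classical_sets constructive_ereal.
From mathcomp Require Import freeg.

Set Implicit Arguments.
Unset Strict Implicit.
Unset Printing Implicit Defensive.

Import Order.TTheory GRing.Theory Num.Theory.
Local Open Scope ring_scope.

(** * Projective dimension over an arbitrary ring *)

(** Dimensions enter the final argument only through this predicate: both sides of the theorem are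
    shown to be the least [n] for the same [P], with infinity when there is none. *)
Definition least_nat (P : nat -> Prop) (x : \bar int) : Prop :=
  (exists n : nat, [/\ x = n%:Z%:E%E, P n & forall m, P m -> (n <= m)%N]) \/
  (x = +oo%E /\ forall n, ~ P n).

Lemma least_natP (P : nat -> Prop) n : P n ->
  exists2 m, P m & forall l, P l -> (m <= l)%N.
Proof.
move=> Pn; have exP : exists n, `[< P n >] by exists n; apply/asboolP.
case: (ex_minnP exP) => m /asboolP Pm mle; exists m => // l Pl.
by apply: mle; apply/asboolP.
Qed.

Lemma infimum_min d (T : porderType d) (x0 m : T) (D : set T) :
  D m -> lbound D m -> infimum x0 D = m.
Proof.
move=> Dm mD; rewrite /infimum ifF; last by apply/eqP => D0; rewrite D0 in Dm.
apply: xget_unique => [|y [yD ylb]]; first by split=> // z; apply.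
by apply/le_anti; rewrite (yD _ Dm) (ylb _ mD).
Qed.

Lemma supremum_eq d (T : porderType d) (x0 s : T) (D : set T) :
  D !=set0%classic -> supremums D s -> supremum x0 D = s.
Proof.
move=> [x Dx] sD.
rewrite /supremum ifF; last by apply/eqP => D0; rewrite D0 in Dx.
by apply: xget_unique => // y yD; apply: is_subset1_supremums yD sD.
Qed.

Definition linear_of (S : pzRingType) (U V : lmodType S) (f : U -> V)
    (lf : linear f) : {linear U -> V} :=
  HB.pack f (GRing.isLinear.Build S U V _ f lf).

(** * Kernels as modules *)

Section Kernel.
Variables (S : pzRingType) (U V : lmodType S) (f : {linear U -> V}).

Definition ker_pred : {pred U} := fun x => f x == 0.

Lemma ker_submod_closed : submod_closed ker_pred.
Proof.
split=> [|a x y]; rewrite !unfold_in ?linear0 // => /eqP fx /eqP fy.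
by rewrite linearP fx fy scaler0 addr0.
Qed.

HB.instance Definition _ :=
  GRing.isSubmodClosed.Build S U ker_pred ker_submod_closed.

Record kermod := Kermod { kerval : U; _ : kerval \in ker_pred }.

HB.instance Definition _ := [isSub for kerval].
HB.instance Definition _ := [Choice of kermod by <:].
HB.instance Definition _ := [SubChoice_isSubLmodule of kermod by <:].

Lemma kerval_linear : linear kerval.
Proof. by []. Qed.

Definition ker_incl : {linear kermod -> U} := linear_of kerval_linear.

End Kernel.

(** * Projective dimension by iterated syzygies *)

Section Homological.
Variable R : pzRingType.
Implicit Types (K M N P Q : rmodType R) (n : nat).

Definition short_exact K P M (i : {linear K -> P}) (e : {linear P -> M}) :=
  [/\ injective i, forall y, exists x, e x = y
    & forall x, e x = 0 <-> exists y, i y = x].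

(** A bound on the projective dimension in recursive form, so that inductions peel off one syzygy at
    a time instead of handling a whole resolution. *)
Fixpoint pdle n M : Prop :=
  if n is n'.+1 then
    exists K P (i : {linear K -> P}) (e : {linear P -> M}),
      [/\ short_exact i e, fin_generated P, projective P & pdle n' K]
  else fin_generated M /\ projective M.

Lemma fin_generatedP M :
  fin_generated M <-> exists n (v : 'I_n -> M),
    forall x, exists c : 'I_n -> R^c, x = \sum_i c i *: v i.
Proof.
split=> [[s Hs]|[[|n] [v Hv]]]; first by exists (size s), (fun i => s`_i).
- exists [::] => x; have [c ->] := Hv x.
  by exists (fun=> 0); rewrite !big_ord0.
exists [seq v i | i <- enum 'I_n.+1] => x; have [c ->] := Hv x.
exists (fun i => c (inord i)).
set s := [seq _ | _ <- _].
rewrite -(big_mkord xpredT (fun i => c (inord i) *: s`_i)).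
rewrite /s size_map size_enum_ord big_mkord; apply: eq_bigr => i _.
by rewrite (nth_map ord0) ?size_enum_ord // nth_ord_enum inord_val.
Qed.

Lemma fin_generated_surj M N (f : {linear M -> N}) :
  (forall y, exists x, f x = y) -> fin_generated M -> fin_generated N.
Proof.
move=> fS /fin_generatedP [n [v Hv]]; apply/fin_generatedP.
exists n, (f \o v) => y; have [x <-] := fS y; have [c ->] := Hv x.
by exists c; rewrite linear_sum; apply: eq_bigr => i _; rewrite linearZ.
Qed.

Lemma fin_generated_prod M N :
  fin_generated M -> fin_generated N -> fin_generated (M * N)%type.
Proof.
move=> /fin_generatedP [m [v Hv]] /fin_generatedP [n [w Hw]].
apply/fin_generatedP; exists (m + n)%N.
exists (fun i => match split i with inl a => (v a, 0) | inr b => (0, w b) end).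
move=> [x y]; have [c xE] := Hv x; have [d yE] := Hw y.
exists (fun i => match split i with inl a => c a | inr b => d b end).
rewrite big_split_ord /=.
under eq_bigr do rewrite (unsplitK (inl _)).
under [X in _ + X]eq_bigr do rewrite (unsplitK (inr _)).
rewrite xE yE; apply/pair_eqP/andP.
rewrite /= !(big_morph (fun z : M * N => z.1) (fun _ _ => erefl) erefl).
rewrite !(big_morph (fun z : M * N => z.2) (fun _ _ => erefl) erefl) /=.
split; apply/eqP; last first.
  by rewrite [X in X + _]big1 ?add0r // => i _; rewrite scaler0.
by rewrite [X in _ + X]big1 ?addr0 // => i _; rewrite scaler0.
Qed.

Lemma projective_lift P M N (g : {linear M -> N}) (f : P -> N) :
  projective P -> linear f -> (forall y, exists x, g x = y) ->
  exists h : {linear P -> M}, forall x, g (h x) = f x.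
Proof. by move=> Pp lf gS; apply: (Pp _ _ g (linear_of lf) gS). Qed.

Lemma projective_retract P Q (i : {linear Q -> P}) (r : {linear P -> Q}) :
  cancel i r -> projective P -> projective Q.
Proof.
move=> iK Pp M N g f gS; have [h Hh] := Pp _ _ g (f \o r) gS.
by exists (h \o i) => x; rewrite /= Hh /= iK.
Qed.

Lemma inl_linear M N : linear (fun x : M => (x, 0) : M * N).
Proof. by move=> a x y; apply/pair_eqP; rewrite /= scaler0 addr0 !eqxx. Qed.

Lemma inr_linear M N : linear (fun y : N => (0, y) : M * N).
Proof. by move=> a x y; apply/pair_eqP; rewrite /= scaler0 addr0 !eqxx. Qed.

Lemma projective_prod P Q :
  projective P -> projective Q -> projective (P * Q)%type.
Proof.
move=> Pp Qp M N g f gS.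
have [h Hh] := Pp _ _ g (f \o linear_of (@inl_linear P Q)) gS.
have [l Hl] := Qp _ _ g (f \o linear_of (@inr_linear P Q)) gS.
have lhl : linear (fun z : P * Q => h z.1 + l z.2).
  by move=> a z t; rewrite /= !linearP scalerDr addrACA.
exists (linear_of lhl) => -[x y] /=.
rewrite linearD Hh Hl /= -linearD; congr (f _).
by apply/pair_eqP; rewrite /= addr0 add0r !eqxx.
Qed.

Lemma pdle_iso n M N (f : {linear M -> N}) (g : {linear N -> M}) :
  cancel f g -> cancel g f -> pdle n M -> pdle n N.
Proof.
move=> fK gK; case: n => [[Mf Mp]|n] /=.
  split; last exact: projective_retract gK Mp.
  by apply: fin_generated_surj Mf => y; exists (g y).
move=> [K [P [i [e [[iI eS ex] Pf Pp Kn]]]]].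
exists K, P, i, (f \o e); split=> //; split=> //= [y|x].
  by have [x xE] := eS (g y); exists x; rewrite /= xE gK.
rewrite -ex; split=> [fe0|->]; last exact: linear0.
by rewrite -[e x]fK fe0 linear0.
Qed.

Lemma pdle_addr n M P :
  fin_generated P -> projective P -> pdle n M -> pdle n (M * P)%type.
Proof.
move=> Pf Pp; case: n => [[Mf Mp]|n] /=.
  by split; [apply: fin_generated_prod|apply: projective_prod].
move=> [K [Q [i [e [[iI eS ex] Qf Qp Kn]]]]].
have li : linear (fun x : K => (i x, 0) : Q * P).
  move=> a x y; rewrite linearP; apply/pair_eqP.
  by rewrite /= scaler0 addr0 !eqxx.
have le : linear (fun z : Q * P => (e z.1, z.2) : M * P).
  by move=> a x y; rewrite /= linearP.
exists K, (Q * P)%type, (linear_of li), (linear_of le).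
split=> //; [split=> /=|exact: fin_generated_prod|exact: projective_prod].
- by move=> x y [] /iI.
- by move=> [x y]; have [z <-] := eS x; exists (z, y).
move=> [x y]; split=> /= [[ex0 ->]|[z [<- <-]]].
  by have /ex [z <-] := ex0; exists z.
by congr pair; apply/ex; exists z.
Qed.

(** In the successor case [s] lifts the inclusion of [P] through [e]. The kernel of the resulting
    map from [Q] to [M] is [K] enlarged by the image of [s], a copy of [K * P], to which [pdle_addr]
    applies. *)
Lemma pdle_cancel n M P :
  fin_generated P -> projective P -> pdle n (M * P)%type -> pdle n M.
Proof.
move=> Pf Pp; case: n => [[MPf MPp]|n] /=.
  have l1 : linear (fun z : M * P => z.1) by [].
  split.
    by apply: (fin_generated_surj (f := linear_of l1)) MPf => y; exists (y, 0).
  have lP := @inl_linear M P.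
  by apply: (projective_retract (i := linear_of lP) (r := linear_of l1)).
move=> [K [Q [i [e [[iI eS ex] Qf Qp Kn]]]]].
have [s Hs] := Pp _ _ e (linear_of (@inr_linear M P)) eS.
have lj : linear (fun z : K * P => i z.1 + s z.2).
  by move=> a z t; rewrite /= !linearP scalerDr addrACA.
have l1 : linear (fun q : Q => (e q).1) by move=> a x y; rewrite linearP.
exists (K * P)%type, Q, (linear_of lj), (linear_of l1).
have ei z : e (i z) = 0 by apply/ex; exists z.
split=> //; last exact: pdle_addr.
split=> /=.
- move=> [x y] [x' y'] /= E.
  have /= := congr1 e E; rewrite !linearD !ei !Hs !add0r => -[Ey].
  by rewrite Ey in E *; move/addIr/iI: E => ->.
- by move=> y; have [x xE] := eS (y, 0); exists x; rewrite xE.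
move=> x; split=> [e0|[[y z] /= <-]]; last by rewrite linearD ei Hs /= addr0.
have /ex [y yE] : e (x - s (e x).2) = 0.
  rewrite linearB Hs; case: (e x) e0 => /= u v ->; apply/pair_eqP.
  by rewrite /= !subrr !eqxx.
by exists (y, (e x).2); rewrite /= yE subrK.
Qed.

Lemma short_exact_factor K P M N (i : {linear K -> P}) (e : {linear P -> M})
    (f : N -> P) :
  short_exact i e -> linear f -> (forall x, e (f x) = 0) ->
  exists h : {linear N -> K}, forall x, i (h x) = f x.
Proof.
move=> [iI _ ex] lf ef0.
have /choice [h Hh] : forall x, exists y, i y = f x by move=> x; apply/ex.
have lh : linear h by move=> a x y; apply: iI; rewrite linearP !Hh lf.
by exists (linear_of lh).
Qed.

(* Schanuel's lemma: both modules are isomorphic to the pullback of P and P'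
   over M. *)
Lemma schanuel K P K' P' M (i : {linear K -> P}) (e : {linear P -> M})
    (i' : {linear K' -> P'}) (e' : {linear P' -> M}) :
  projective P -> projective P' -> short_exact i e -> short_exact i' e' ->
  exists (f : {linear (K * P')%type -> (K' * P)%type})
         (g : {linear (K' * P)%type -> (K * P')%type}),
    cancel f g /\ cancel g f.
Proof.
move=> Pp Pp' E E'; have [iI eS ex] := E; have [iI' eS' ex'] := E'.
have [a Ha] := Pp' _ _ e e' eS; have [b Hb] := Pp _ _ e' e eS'.
have ei z : e (i z) = 0 by apply/ex; exists z.
have ei' z : e' (i' z) = 0 by apply/ex'; exists z.
(* For [z] in [K * P'] the pair [(p z, z.2)] lies in the pullback; its coordinate in [K'] is the
   correction [z.2 - b (p z)], which [e'] kills. *)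
pose p (z : K * P') := i z.1 + a z.2; pose p' (z : K' * P) := i' z.1 + b z.2.
have lp : linear p by move=> c z t; rewrite /p /= !linearP scalerDr addrACA.
have lp' : linear p' by move=> c z t; rewrite /p' /= !linearP scalerDr addrACA.
have ep z : e (p z) = e' z.2 by rewrite /p linearD ei add0r Ha.
have ep' z : e' (p' z) = e z.2 by rewrite /p' linearD ei' add0r Hb.
have [|z|q Hq] := short_exact_factor (f := fun z => z.2 - b (p z)) E'.
- by move=> c z t; rewrite /= lp linearP scalerBr addrACA opprD.
- by rewrite linearB Hb ep subrr.
have [|z|q' Hq'] := short_exact_factor (f := fun z => z.2 - a (p' z)) E.
- by move=> c z t; rewrite /= lp' linearP scalerBr addrACA opprD.
- by rewrite linearB Ha ep' subrr.
have lf : linear (fun z => (q z, p z)) by move=> c z t; rewrite linearP lp.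
have lg : linear (fun z => (q' z, p' z)) by move=> c z t; rewrite linearP lp'.
exists (linear_of lf), (linear_of lg); split=> z /=.
  have p'E : p' (q z, p z) = z.2 by rewrite /p' Hq subrK.
  rewrite p'E [RHS]surjective_pairing; congr pair; apply: iI.
  by rewrite Hq' p'E /p addrK.
have pE : p (q' z, p' z) = z.2 by rewrite /p Hq' subrK.
rewrite pE [RHS]surjective_pairing; congr pair; apply: iI'.
by rewrite Hq pE /p' addrK.
Qed.

(** Schanuel compares [K] with the syzygy that [pdle] provides. They agree up to finitely generated
    projective summands, which [pdle_addr] and [pdle_cancel] add and remove. *)
Lemma pdle_syzygy n K P M (i : {linear K -> P}) (e : {linear P -> M}) :
  short_exact i e -> fin_generated P -> projective P ->
  pdle n.+1 M -> pdle n K.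
Proof.
move=> E Pf Pp [K' [P' [i' [e' [E' Pf' Pp' Kn']]]]].
have [f [g [fK gK]]] := schanuel Pp Pp' E E'.
apply: (pdle_cancel Pf' Pp'); apply: pdle_iso gK fK _.
exact: pdle_addr.
Qed.

Lemma ker_short_exact P M (e : {linear P -> M}) :
  (forall y, exists x, e x = y) -> short_exact (ker_incl e) e.
Proof.
move=> eS; split=> //; first exact: val_inj.
move=> x; split=> [ex|[[y yP] <-]]; last exact/eqP.
by have xP : x \in ker_pred e by [rewrite unfold_in ex]; exists (Kermod xP).
Qed.

Lemma fin_generated0 : fin_generated ('rV[R^c]_0 : rmodType R).
Proof.
apply/fin_generatedP; exists 0%N, (fun=> 0) => x; exists (fun=> 0).
by rewrite big_ord0; apply/rowP => -[].
Qed.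

Lemma free_projective n : projective ('rV[R^c]_n : rmodType R).
Proof.
move=> M N g f gS.
have /choice [v Hv] : forall i, exists m, g m = f (delta_mx 0 i).
  by move=> i; apply: gS.
have lh : linear (fun x : 'rV[R^c]_n => \sum_i x 0 i *: v i).
  move=> a x y; rewrite scaler_sumr -big_split; apply: eq_bigr => i _ /=.
  by rewrite !mxE scalerDl scalerA.
exists (linear_of lh) => x /=; rewrite linear_sum [in RHS](row_sum_delta x).
by rewrite linear_sum; apply: eq_bigr => i _; rewrite !linearZ /= Hv.
Qed.

Lemma free_fin_generated n : fin_generated ('rV[R^c]_n : rmodType R).
Proof.
apply/fin_generatedP; exists n, (fun i => delta_mx 0 i) => x.
by exists (x 0); exact: row_sum_delta.
Qed.

Lemma free_cover M : fin_generated M ->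
  exists P (e : {linear P -> M}),
    [/\ fin_generated P, projective P & forall y, exists x, e x = y].
Proof.
move=> /fin_generatedP [n [v Hv]].
have le : linear (fun x : 'rV[R^c]_n => \sum_i x 0 i *: v i).
  move=> a x y; rewrite scaler_sumr -big_split; apply: eq_bigr => i _ /=.
  by rewrite !mxE scalerDl scalerA.
exists ('rV[R^c]_n), (linear_of le); split.
- exact: free_fin_generated.
- exact: free_projective.
move=> y; have [c ->] := Hv y; exists (\row_i c i) => /=.
by apply: eq_bigr => i _; rewrite mxE.
Qed.

Lemma pdle_resolution n M : pdle n M -> proj_resolution_length_le M n.
Proof.
elim: n M => [|n IH] M /=.
  move=> [Mf Mp].
  (* [M] resolves itself: all terms after the first are the zero module, realised by rows of length
     0. *)
  pose Z : rmodType R := 'rV[R^c]_0.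
  have z0 (x : Z) : x = 0 by apply/rowP => -[].
  pose P m : rmodType R := if m is 0%N then M else Z.
  have ld m : linear (fun _ : P m.+1 => 0 : P m).
    by move=> a x y; rewrite scaler0 addr0.
  exists P, (fun m => linear_of (ld m)), idfun; split; last first.
    by case=> // m _ x; apply: z0.
  split=> /=.
  - case=> [|m] //; split; [exact: fin_generated0|exact: free_projective].
  - by move=> y; exists y.
  - by move=> x; split=> [->|[_ <-]] //; exists 0.
  - by move=> m x; split=> // _; exists 0; rewrite (z0 x).
move=> [K [Q [i [e [[iI eS ex] Qf Qp /IH]]]]].
move=> [P [d [eps [[Pfp epsS epsx dx] P0]]]].
(* The resolution of [K] is shifted by one place and spliced to [Q] along [i \o eps]. *)
pose P' m : rmodType R := if m is m'.+1 then P m' else Q.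
pose d' m : {linear P' m.+1 -> P' m} :=
  if m is m'.+1 return {linear P' m.+1 -> P' m} then d m' else i \o eps.
exists P', d', e; split; last by case=> [|m] // mn x; apply: P0.
split=> //.
- by case=> [|m] //=; apply: Pfp.
- move=> x; rewrite ex; split=> [[y <-]|[y <-]]; last by exists (eps y).
  by have [z <-] := epsS y; exists z.
case=> [|m] /= x; last exact: dx.
rewrite -epsx; split=> [E|->]; last exact: linear0.
by apply: iI; rewrite E linear0.
Qed.

Lemma resolution_pdle n M : proj_resolution_length_le M n -> pdle n M.
Proof.
elim: n M => [|n IH] M [P [d [eps [[Pfp epsS epsx dx] P0]]]].
  (* In length 0 the term [P 1] vanishes, so [eps] is an isomorphism from [P 0] onto [M]. *)
  have eI : injective eps.
    move=> x y E; apply/eqP; rewrite -subr_eq0; apply/eqP.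
    have /epsx [z <-] : eps (x - y) = 0 by rewrite linearB E subrr.
    by rewrite (P0 1%N isT z) linear0.
  have /choice [g gK] := epsS.
  have lg : linear g by move=> a x y; apply: eI; rewrite linearP !gK.
  by apply: (@pdle_iso 0 (P 0%N) M eps (linear_of lg)) => [x||//]; [apply: eI|].
(* The terms from [P 1] on resolve the kernel of [eps]; the augmentation [h] is [d 0] with
   restricted codomain. *)
have E := ker_short_exact epsS.
have [P0f P0p] := Pfp 0%N.
exists (kermod eps), (P 0%N), (ker_incl eps), eps; split=> //.
have ed x : eps (d 0%N x) = 0 by apply/epsx; exists x.
have [h Hh] := short_exact_factor E (linearP (d 0%N)) ed.
apply: IH; exists (fun m => P m.+1), (fun m => d m.+1), h.
split=> //; last by move=> m mn x; apply: P0.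
have incl0 y : h y = 0 <-> d 0%N y = 0.
  rewrite -Hh; split=> [->|]; first exact: linear0.
  by move=> h0; apply: val_inj; rewrite h0.
split=> // [y|x]; last by rewrite incl0.
have [_ _ ex] := E.
have /epsx [x xE] : eps (ker_incl eps y) = 0 by apply/ex; exists y.
by exists x; apply: val_inj; rewrite -xE -Hh.
Qed.

Lemma pdleS n M : pdle n M -> pdle n.+1 M.
Proof.
move=> /pdle_resolution [P [d [eps [H P0]]]]; apply: resolution_pdle.
by exists P, d, eps; split=> // i ni; apply: P0; apply: leq_trans ni.
Qed.

Lemma pdle_leq m n M : (m <= n)%N -> pdle m M -> pdle n M.
Proof. by move=> /subnK <-; elim: (n - m)%N => // l IH /IH /pdleS. Qed.

Lemma projdim_leastn M : least_nat (fun n => pdle n M) (projdim M).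
Proof.
have -> : (fun n => pdle n M) = proj_resolution_length_le M.
  by apply/funext => n; apply/propext; split;
    [apply: pdle_resolution|apply: resolution_pdle].
rewrite /projdim.
have [[n]|no] := pselect (exists n, proj_resolution_length_le M n).
  move=> /least_natP [m Mm mle]; left; exists m; split=> //.
  apply: infimum_min; first by exists m.
  by move=> _ [l /mle ml <-]; rewrite lee_fin lez_nat.
right; split=> [|n Mn]; last by apply: no; exists n.
rewrite /infimum ifT //; apply/eqP; rewrite predeqE => x; split=> // -[n Mn _].
by apply: no; exists n.
Qed.

(** Minimality of a uniform bound [m.+1] yields a module violating [pdle m], so the supremum is
    reached; without a uniform bound the projective dimensions exceed every integer. *)
Lemma gldim_leastn :
  least_nat (fun n => forall M, fin_generated M -> pdle n M) (gldim R).
Proof.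
rewrite /gldim; set D := (X in supremum _ X); pose Z : rmodType R := 'rV[R^c]_0.
(* The set is nonempty, so [supremum] does not fall back on its default value. *)
have DZ : D (projdim Z) by exists Z => //; apply: fin_generated0.
have [[n]|no] :=
    pselect (exists n, forall M, fin_generated M -> pdle n M).
  move=> /(@least_natP (fun n => forall M, fin_generated M -> pdle n M)).
  move=> [m Mm mle]; left; exists m; split=> //.
  apply: supremum_eq; first by exists (projdim Z).
  split=> [_ [M Mf ->]|b bD].
    case: (projdim_leastn M) => [[l [-> _]]|[_ /(_ m)[]]]; last exact: Mm.
    by rewrite lee_fin lez_nat; apply; apply: Mm.
  (* For [m = 0] there is no smaller bound to refute; it suffices that the projective dimension of
     [Z] is nonnegative. *)
  case: m Mm mle => [_ _|m _ mle].
    apply: le_trans (bD _ DZ).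
    case: (projdim_leastn Z) => [[l [-> _ _]]|[-> _]].
      by rewrite lee_fin.
    exact: leey.
  have [M [Mf Mm]] : exists M, fin_generated M /\ ~ pdle m M.
    apply: contrapT => H; suff: (m < m)%N by rewrite ltnn.
    apply: mle => M Mf; apply: contrapT => Mm.
    by apply: H; exists M.
  have /bD : D (projdim M) by exists M.
  apply: le_trans; case: (projdim_leastn M) => [[l [-> Ml _]]|[-> _]].
    rewrite lee_fin lez_nat ltnNge; apply/negP => lm.
    exact/Mm/(pdle_leq lm).
  exact: leey.
right; split=> [|n Mn]; last by apply: no; exists n.
apply: supremum_eq; first by exists (projdim Z).
split=> [x _|b bD]; first exact: leey.
have big n : exists2 M : rmodType R, D (projdim M) & ~ (projdim M <= n%:Z%:E)%E.
  apply: contrapT => H; apply: no; exists n => M Mf.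
  apply: contrapT => Mn; apply: H; exists M; first by exists M.
  case: (projdim_leastn M) => [[l [-> Ml _]]|[-> _]] //.
  rewrite lee_fin lez_nat => ln; exact/Mn/(pdle_leq ln).
case: b bD => [r||] bD //.
  (* The absolute value replaces the integer bound [r] by a natural number at least as large. *)
  have [M MD []] := big `|r|%N; apply: le_trans (bD _ MD) _.
  by rewrite lee_fin abszE ler_norm.
have [M MD []] := big 0%N; apply: le_trans (bD _ MD) _; exact: leNye.
Qed.

End Homological.

(** * Finite-dimensional vector spaces *)

Section FiniteDimension.
Variable k : fieldType.
Implicit Types U V W : lmodType k.

Definition fin_dim V : Prop := exists n (v : 'I_n -> V),
  forall x, exists c : 'I_n -> k, x = \sum_i c i *: v i.

Lemma linear_fun0 V W (f : V -> W) : linear f -> f 0 = 0.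
Proof. by move=> lf; exact: linear0 (linear_of lf). Qed.

Lemma linear_combination V W (f : V -> W) n (c : 'I_n -> k) (v : 'I_n -> V) :
  linear f -> f (\sum_i c i *: v i) = \sum_i c i *: f (v i).
Proof.
move=> lf; rewrite -[f]/(linear_of lf : V -> W) linear_sum.
by apply: eq_bigr => i _; rewrite linearZ.
Qed.

(* The [v i] form a basis of a complement of the subspace [Y]; [c] gives the
   coordinates modulo [Y]. *)
Lemma fin_dim_complement V (Y : V -> Prop) :
  Y 0 -> (forall a x y, Y x -> Y y -> Y (a *: x + y)) -> fin_dim V ->
  exists n (v : 'I_n -> V) (c : V -> 'I_n -> k),
    [/\ forall x, Y (x - \sum_i c x i *: v i),
        forall a x y i, c (a *: x + y) i = a * c x i + c y i
      & forall x, Y x -> forall i, c x i = 0].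
Proof.
move=> Y0 YL [n0 [v0 V0]].
have YD x y : Y x -> Y y -> Y (x + y).
  by rewrite -[x in x + y]scale1r; apply: YL.
have YZ a x : Y x -> Y (a *: x) by move=> Yx; rewrite -[_ *: _]addr0; apply: YL.
have YB x y : Y x -> Y y -> Y (x - y).
  by move=> Yx Yy; apply: YD => //; rewrite -scaleN1r; apply: YZ.
pose gen n := exists v : 'I_n -> V,
  forall x, exists c : 'I_n -> k, Y (x - \sum_i c i *: v i).
have gen0 : gen n0.
  by exists v0 => x; have [c ->] := V0 x; exists c; rewrite subrr.
have [n [v Hv] nmin] := least_natP gen0.
(* In a spanning family modulo [Y] of least length, a relation with [c i] nonzero would allow [v i]
   to be eliminated. *)
have free (c : 'I_n -> k) : Y (\sum_i c i *: v i) -> forall i, c i = 0.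
  move=> Yc i; apply/eqP; apply: contraT => ci0.
  case: n v Hv nmin c Yc i ci0 => [v _ _ _ _ [] //|n v Hv nmin c Yc i ci0].
  suff /nmin : gen n by rewrite ltnn.
  exists (v \o fintype.lift i) => x; have [d Yd] := Hv x.
  exists (fun j => d (fintype.lift i j) - d i / c i * c (fintype.lift i j)).
  set w := \sum_j _.
  suff -> : w = \sum_j d j *: v j - d i / c i *: \sum_j c j *: v j.
    by rewrite opprB addrCA; apply: YD => //; apply: YZ.
  rewrite !(bigD1_ord i) //= scalerDr opprD addrACA scalerA divfK // subrr.
  rewrite add0r.
  rewrite scaler_sumr -sumrB; apply: eq_bigr => j _.
  by rewrite scalerBl scalerA.
have /choice [c Hc] := Hv.
have uniqc x (d : 'I_n -> k) :
    Y (x - \sum_i d i *: v i) -> forall i, c x i = d i.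
  move=> Yd i; apply/eqP; rewrite -subr_eq0; apply/eqP.
  apply: (free (fun i => c x i - d i)).
  have := YB _ _ Yd (Hc x); rewrite opprB addrC addrA subrK -sumrB.
  by congr Y; apply: eq_bigr => j _; rewrite scalerBl.
exists n, v, c; split=> // [a x y|x Yx]; last first.
  by apply: (uniqc _ (fun=> 0)); rewrite big1 ?subr0 // => i _; rewrite scale0r.
apply: (uniqc _ (fun i => a * c x i + c y i)).
have := YL a _ _ (Hc x) (Hc y); congr Y.
rewrite scalerBr addrACA -opprD; congr (_ - _).
rewrite scaler_sumr -big_split; apply: eq_bigr => i _ /=.
by rewrite scalerDl scalerA.
Qed.

(** Removing the component in a complement of the image of [j] leaves an element of the image; its
    preimage is the value of the retraction. *)
Lemma fin_dim_retraction U V (j : U -> V) :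
  linear j -> injective j -> fin_dim V ->
  exists2 r : V -> U, linear r & cancel j r.
Proof.
move=> lj jI Vf; pose Y x := exists y, j y = x.
have [||n [v [c [Hc lc c0]]]] := @fin_dim_complement V Y _ _ Vf.
- by exists 0; exact: linear_fun0.
- by move=> a _ _ [x <-] [y <-]; exists (a *: x + y); rewrite lj.
have /choice [r Hr] := Hc.
exists r => [a x y|y]; apply: jI.
  rewrite lj !Hr scalerBr addrACA -opprD; congr (_ - _).
  rewrite scaler_sumr -big_split; apply: eq_bigr => i _ /=.
  by rewrite lc scalerDl scalerA.
rewrite Hr big1 ?subr0 // => i _; rewrite c0 ?scale0r //; by exists y.
Qed.

Lemma fin_dim_lift V W U (g : W -> U) (f : V -> U) :
  linear g -> linear f -> (forall y, exists x, g x = y) -> fin_dim V ->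
  exists2 s : V -> W, linear s & forall x, g (s x) = f x.
Proof.
move=> lg lf gS Vf.
(* A complement of the zero subspace is all of [V], so [v] is a basis and [c] gives its
   coordinates. *)
have [||n [v [c [Hc lc _]]]] :=
  @fin_dim_complement V (fun x => x = 0) _ _ Vf => //.
  by move=> a _ _ -> ->; rewrite scaler0 addr0.
have /choice [w Hw] : forall i, exists x, g x = f (v i) by move=> i; apply: gS.
exists (fun x => \sum_i c x i *: w i) => [a x y|x].
  rewrite scaler_sumr -big_split; apply: eq_bigr => i _ /=.
  by rewrite lc scalerDl scalerA.
have /eqP := Hc x; rewrite subr_eq0 => /eqP {2}->.
rewrite !linear_combination //.
by apply: eq_bigr => i _; rewrite Hw.
Qed.

Lemma fin_dim_surj U V (f : U -> V) :
  linear f -> (forall y, exists x, f x = y) -> fin_dim U -> fin_dim V.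
Proof.
move=> lf fS [n [v Hv]]; exists n, (f \o v) => y.
have [x <-] := fS y; have [c ->] := Hv x; exists c.
exact: linear_combination.
Qed.

Lemma fin_dim_inj U V (j : U -> V) :
  linear j -> injective j -> fin_dim V -> fin_dim U.
Proof.
move=> lj jI Vf; have [r lr rK] := fin_dim_retraction lj jI Vf.
by apply: fin_dim_surj lr _ Vf => y; exists (j y).
Qed.

Inductive spans V (s : seq V) : V -> Prop :=
| spans0 : spans s 0
| spansD a x y : x \in s -> spans s y -> spans s (a *: x + y).

Lemma spans_mem V (s : seq V) x : x \in s -> spans s x.
Proof.
move=> sx; rewrite -[x]scale1r -[_ *: _]addr0.
by apply: spansD => //; constructor.
Qed.

Lemma spans_linear V (s : seq V) a x y :
  spans s x -> spans s y -> spans s (a *: x + y).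
Proof.
move=> sx sy; elim: sx => [|b z t zs _ IH]; first by rewrite scaler0 add0r.
by rewrite scalerDr scalerA -addrA; constructor.
Qed.

Lemma spans_add V (s : seq V) x y : spans s x -> spans s y -> spans s (x + y).
Proof. by move=> sx sy; rewrite -[x]scale1r; apply: spans_linear. Qed.

Lemma spans_sub V (s t : seq V) x : {subset s <= t} -> spans s x -> spans t x.
Proof. by move=> st; elim=> [|a y z /st yt _]; constructor. Qed.

Lemma spans_bilinear U V W (f : U -> V -> W) (s : seq U) (t : seq V) x y :
  (forall v, linear (f^~ v)) -> (forall u, linear (f u)) ->
  spans s x -> spans t y -> spans [seq f u v | u <- s, v <- t] (f x y).
Proof.
move=> lf1 lf2 sx ty; elim: sx => [|a u x' us _ IH].
  by rewrite (linear_fun0 (lf1 y)); constructor.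
rewrite lf1; apply: spans_linear => //.
elim: ty => [|b v y' vt _ IH'].
  by rewrite (linear_fun0 (lf2 u)); constructor.
by rewrite lf2; constructor=> //; apply: allpairs_f.
Qed.

Lemma fin_dim_spans V (s : seq V) : (forall x, spans s x) -> fin_dim V.
Proof.
move=> sV; exists (size s), (fun i => s`_i) => x.
elim: {x}(sV x) => [|a x y xs _ [c ->]].
  by exists (fun=> 0); rewrite big1 // => i _; rewrite scale0r.
have xi : (index x s < size s)%N by rewrite index_mem.
pose i0 := Ordinal xi.
exists (fun i => (if i == i0 then a else 0) + c i).
under [RHS]eq_bigr do rewrite scalerDl.
rewrite big_split /=; congr (_ + _).
rewrite (bigD1 i0) //= eqxx nth_index // big1 ?addr0 // => i /negPf ->.
by rewrite scale0r.
Qed.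

End FiniteDimension.

(** * Modules from representations *)

(** Restriction of scalars along [phi]. The alias lets the elements of [M] carry a second module
    structure without a clash with the first. *)
Definition restrict (k S : pzRingType) (phi : {rmorphism k -> S})
  (M : lmodType S) : Type := M.

Section Restriction.
Variables (k S : pzRingType) (phi : {rmorphism k -> S}) (M : lmodType S).

HB.instance Definition _ := GRing.Zmodule.on (restrict phi M).

Definition restrict_scale (c : k) (x : restrict phi M) : restrict phi M :=
  phi c *: (x : M).

Lemma restrict_scaleA a b x :
  restrict_scale a (restrict_scale b x) = restrict_scale (a * b) x.
Proof. by rewrite /restrict_scale scalerA -rmorphM. Qed.

Lemma restrict_scale1 : left_id 1 restrict_scale.
Proof. by move=> x; rewrite /restrict_scale rmorph1 scale1r. Qed.

Lemma restrict_scaleDr : right_distributive restrict_scale +%R.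
Proof. by move=> a x y; rewrite /restrict_scale scalerDr. Qed.

Lemma restrict_scaleDl x : {morph restrict_scale^~ x : a b / a + b}.
Proof. by move=> a b; rewrite /restrict_scale rmorphD scalerDl. Qed.

HB.instance Definition _ := GRing.Zmodule_isLmodule.Build k (restrict phi M)
  restrict_scaleA restrict_scale1 restrict_scaleDr restrict_scaleDl.

Lemma restrictE c (x : M) : c *: (x : restrict phi M) = phi c *: x :> M.
Proof. by []. Qed.

End Restriction.

Lemma restrict_linear (k S : pzRingType) (phi : {rmorphism k -> S})
    (M N : lmodType S) (f : M -> N) :
  linear f -> linear (f : restrict phi M -> restrict phi N).
Proof. by move=> lf a x y; exact: lf. Qed.

Section Scalars.
Variables (k : fieldType) (B : falgType k).

Definition alg_scalar (c : k) : B^c := (c%:A : B).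

Lemma alg_scalar_additive : zmod_morphism alg_scalar.
Proof. by move=> c d; apply: (raddfB (in_alg B)). Qed.

Lemma alg_scalar_monoid : monoid_morphism alg_scalar.
Proof.
split=> [|c d]; first exact: scale1r.
by rewrite mulrC; apply: (rmorphM (in_alg B)).
Qed.

HB.instance Definition _ :=
  GRing.isZmodMorphism.Build k B^c alg_scalar alg_scalar_additive.
HB.instance Definition _ :=
  GRing.isMonoidMorphism.Build k B^c alg_scalar alg_scalar_monoid.

Definition alg_scalars : {rmorphism k -> B^c} := alg_scalar.
End Scalars.

Section GPScalars.
Variables (k : fieldType) (Q : quiver) (A : vertex Q -> falgType k).
Local Notation L := (gp_algebra A).

Definition gp_scalar (c : k) : L^c := (c *: (1 : L)).

Lemma gp_scalar_additive : zmod_morphism gp_scalar.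
Proof. by move=> c d; rewrite /gp_scalar scalerBl. Qed.

Lemma gp_scalar_monoid : monoid_morphism gp_scalar.
Proof.
split=> [|c d]; first exact: scale1r.
rewrite /gp_scalar -[RHS]/((d *: (1 : L)) * (c *: (1 : L))).
by rewrite -gp_scaleAl mul1r scalerA mulrC.
Qed.

HB.instance Definition _ :=
  GRing.isZmodMorphism.Build k L^c gp_scalar gp_scalar_additive.
HB.instance Definition _ :=
  GRing.isMonoidMorphism.Build k L^c gp_scalar gp_scalar_monoid.

Definition gp_scalars : {rmorphism k -> L^c} := gp_scalar.
End GPScalars.

Section Representations.
Variables (k : fieldType) (Q : quiver) (A : vertex Q -> falgType k).
Local Notation L := (gp_algebra A).

(* The arrows act by arbitrary k-linear maps: the bimodule of an arrow from i to
   j is the tensor product of [A i] and [A j] over k. *)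
Record gp_rep := GPRep {
  rep_space : lmodType k;
  rep_alg : forall i, A i -> rep_space -> rep_space;
  rep_arrow : arrow Q -> rep_space -> rep_space;
  rep_alg_linearl : forall i u, linear (fun a : A i => rep_alg a u);
  rep_alg_linearr : forall i (a : A i), linear (rep_alg a);
  rep_arrow_linear : forall b, linear (rep_arrow b);
  rep_algM : forall i (a b : A i) u,
    rep_alg (a * b) u = rep_alg b (rep_alg a u);
  rep_alg0 : forall i j (a : A i) (b : A j) u, i != j ->
    rep_alg b (rep_alg a u) = 0;
  rep_alg1 : forall u, \sum_i rep_alg (1 : A i) u = u
}.

Section RepMod.
Variable r : gp_rep.
Local Notation U := (rep_space r).

Fixpoint rep_path j i (p : apath A j i) (u : U) : U :=
  match p with
  | APnil a => rep_alg a u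
  | APcons b a p => rep_path p (rep_arrow b (rep_alg a u))
  end.

Lemma rep_path_linear j i (p : apath A j i) : linear (rep_path p).
Proof.
elim: p => [a|b a p IH] c u v /=; first exact: rep_alg_linearr.
by rewrite rep_alg_linearr rep_arrow_linear IH.
Qed.

Lemma rep_path_lin c j i (p q s : apath A j i) u : apath_lin c p q s ->
  rep_path s u = c *: rep_path p u + rep_path q u.
Proof.
move=> H; elim: H u => [x y|b x y {}p|b a {}p {}q {}s _ IH] u //=.
- exact: rep_alg_linearl.
- by rewrite rep_alg_linearl rep_arrow_linear rep_path_linear.
Qed.

Lemma rep_path_lmul j i (a : A i) (p : apath A j i) u :
  rep_path (apath_lmul a p) u = rep_path p (rep_alg a u).
Proof. by case: p a => /= [c|b c p] a; rewrite rep_algM. Qed.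

Lemma rep_path_cat j i (p : apath A j i) l (q : apath A l j) u :
  rep_path (apath_cat p q) u = rep_path q (rep_path p u).
Proof. by elim: p u => [a|b a p IH] u /=; rewrite ?rep_path_lmul ?IH. Qed.

Lemma rep_path_end l j i (p : apath A j i) (a : A l) u : j != l ->
  rep_alg a (rep_path p u) = 0.
Proof. by move=> jl; elim: p u => [b|b c p IH] u //=; apply: rep_alg0. Qed.

Lemma rep_path_disjoint j i (p : apath A j i) j' i' (q : apath A j' i') u :
  j != i' -> rep_path q (rep_path p u) = 0.
Proof.
case: q => [a|b a q] ji' /=; rewrite rep_path_end //.
by rewrite !(linear_fun0 (rep_arrow_linear _), linear_fun0 (rep_path_linear _)).
Qed.

Local Notation V := {freeg (any_apath A) / k}.

Definition rep_free (x : V) (u : U) : U :=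
  fglift (fun p : any_apath A => rep_path (ap_val p) u) x.

Lemma rep_free_linearl u : linear (rep_free^~ u).
Proof. by move=> c x y; rewrite /rep_free fgliftD fgliftZ. Qed.

Lemma rep_free_linearr x : linear (rep_free x).
Proof.
elim/freeg_ind1: x => [|d x y Hx Hy|p] c u v.
- by rewrite /rep_free !fglift0 scaler0 addr0.
- rewrite !rep_free_linearl Hx Hy !scalerDr !scalerA [d * c]mulrC addrACA.
  by rewrite !addrA.
- by rewrite /rep_free !fglift1 rep_path_linear.
Qed.

Lemma rep_free_class j i (p : apath A j i) u :
  rep_free (ap_class p) u = rep_path p u.
Proof. by rewrite /rep_free /ap_class fglift1. Qed.

Lemma rep_freeM x y u : rep_free (free_mul x y) u = rep_free y (rep_free x u).
Proof.
have f0 (z : V) : rep_free z 0 = 0 := linear_fun0 (rep_free_linearr z).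
have f0' v : rep_free 0 v = 0 := linear_fun0 (rep_free_linearl v).
elim/freeg_ind1: x => [|c x x' Hx Hx'|p].
- by rewrite free_mul0l !f0' f0.
- by rewrite free_mulLl !rep_free_linearl Hx Hx' rep_free_linearr.
elim/freeg_ind1: y => [|c y y' Hy Hy'|q].
- by rewrite free_mul0r !f0'.
- by rewrite free_mulLr !rep_free_linearl Hy Hy'.
rewrite free_mul11.
case: p q => [i j p] [i' j' q]; have [e|n] := eqVneq j i'.
  by rewrite -{i'}e in q *; rewrite ap_mulE !rep_free_class rep_path_cat.
by rewrite ap_mul0 // f0' /rep_free !fglift1 /= rep_path_disjoint.
Qed.

(** A path acts linearly in each of its entries, by [rep_path_lin], so the relations act as zero and
    the action passes to the quotient [gp_algebra]. *)
Lemma rep_free_rel x u : x \in @multilin_rel k Q A -> rep_free x u = 0.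
Proof.
rewrite unfold_in => /asboolP /(_ (fun x => rep_free x u = 0)); apply.
- exact: linear_fun0 (rep_free_linearl u).
- by move=> c y z; rewrite rep_free_linearl => -> ->; rewrite scaler0 addr0.
move=> c j i p q s H.
rewrite addrC -scaleN1r !rep_free_linearl !rep_free_class (rep_path_lin _ H).
by rewrite scaleN1r addNr.
Qed.

Definition rep_mod : Type := U.
HB.instance Definition _ := GRing.Zmodule.on rep_mod.

(** Defined on a chosen representative; [rep_act_class] shows that the choice is immaterial. *)
Definition rep_act (x : L^c) (u : rep_mod) : rep_mod :=
  rep_free (gp_repr (x : L)) u.

Lemma rep_act_class x u : rep_act (gp_class x) u = rep_free x u.
Proof.
apply/eqP; rewrite -subr_eq0 -[- _]scaleN1r [X in X == _]addrC.
by rewrite -rep_free_linearl scaleN1r addrC rep_free_rel ?gp_repr_class.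
Qed.

Lemma rep_actA x y u : rep_act x (rep_act y u) = rep_act (x * y) u.
Proof.
rewrite -[x]gp_reprK -[y]gp_reprK; set x' := gp_repr x; set y' := gp_repr y.
(* The product of [L^c] is that of [L] in the opposite order. *)
have -> : (gp_class x' : L^c) * gp_class y' = gp_class (free_mul y' x').
  exact: gp_class_mul.
by rewrite !rep_act_class rep_freeM.
Qed.

Lemma rep_act1 : left_id 1 rep_act.
Proof.
move=> u; rewrite [1 in LHS](_ : _ = gp_class (free_one A) :> L^c) //.
rewrite rep_act_class /rep_free /free_one fglift_sum -[RHS](rep_alg1 u).
by apply: eq_bigr => i _; rewrite fglift1.
Qed.

Lemma rep_actDr : right_distributive rep_act +%R.
Proof.
move=> x u v; rewrite /rep_act -[u in LHS]scale1r rep_free_linearr.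
by rewrite scale1r.
Qed.

Lemma rep_actDl u : {morph rep_act^~ u : x y / x + y}.
Proof.
move=> x y; rewrite -[x]gp_reprK -[y]gp_reprK.
set x' := gp_repr x; set y' := gp_repr y.
have -> : (gp_class x' : L^c) + gp_class y' = gp_class (1 *: x' + y').
  by rewrite scale1r raddfD.
by rewrite !rep_act_class rep_free_linearl scale1r.
Qed.

HB.instance Definition _ := GRing.Zmodule_isLmodule.Build L^c rep_mod
  rep_actA rep_act1 rep_actDr rep_actDl.

Lemma rep_modE j i (p : apath A j i) (u : rep_mod) :
  (gp_path p : L^c) *: u = rep_path p u.
Proof. by rewrite -rep_free_class -rep_act_class. Qed.

Lemma rep_mod_scale c (u : rep_mod) : gp_scalar A c *: u = c *: (u : U) :> U.
Proof.
have -> : gp_scalar A c = gp_class (c *: free_one A) by exact: gp_class_scale.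
rewrite [LHS]rep_act_class -[c *: _]addr0 rep_free_linearl.
rewrite (linear_fun0 (rep_free_linearl u)) addr0; congr (_ *: _).
rewrite -[RHS](rep_act1 u) -rep_act_class //.
Qed.

End RepMod.
End Representations.

(** * Generators and finite dimension *)

Lemma restrict_fin_generated (k : fieldType) (R : pzRingType)
    (phi : {rmorphism k -> R^c}) (M : rmodType R) :
  fin_dim (restrict phi M : lmodType k) -> fin_generated M.
Proof.
move=> [n [v Hv]]; apply/fin_generatedP; exists n, v => x.
by have [c ->] := Hv x; exists (phi \o c).
Qed.

(** * Path lengths in an acyclic quiver *)

Section Acyclic.
Variables (Q : quiver) (aQ : acyclic Q).

(** A repeated arrow [x] would cut out a closed path [x :: s1], which acyclicity forbids. *)
Lemma acyclic_uniq (s : seq (arrow Q)) :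
  sorted (fun b c => target b == source c) s -> uniq s.
Proof.
elim: s => //= x s IH xs; rewrite IH ?(path_sorted xs) // andbT.
apply/negP => /splitPr sE; case: sE xs => s1 s2.
rewrite -cat_rcons cat_path => /andP [xs _].
by have := aQ (p := x :: s1) xs.
Qed.

Variables (k : fieldType) (A : vertex Q -> falgType k).

Fixpoint apath_arrows j i (p : apath A j i) : seq (arrow Q) :=
  if p is APcons b _ p then b :: apath_arrows p else [::].

(** No arrow is traversed twice, by [acyclic_uniq]. *)
Lemma size_apath_arrows j i (p : apath A j i) :
  (size (apath_arrows p) <= #|arrow Q|)%N.
Proof.
have path_arrows i' (p' : apath A j i') b : target b = i' ->
    path (fun b c => target b == source c) b (apath_arrows p').
  by elim: p' b => //= c a p' IH b ->; rewrite eqxx IH.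
have : sorted (fun b c => target b == source c) (apath_arrows p).
  by case: p => //= b a p; apply: path_arrows.
by move=> /acyclic_uniq /card_uniqP <-; apply: max_card.
Qed.

End Acyclic.

Section Generators.
Variables (k : fieldType) (Q : quiver) (A : vertex Q -> falgType k).
Local Notation L := (gp_algebra A).

Definition gp_vertex i (a : A i) : L := gp_path (APnil a).

Definition gp_arrow (b : arrow Q) : L :=
  gp_path (@APcons k Q A _ b 1 (APnil 1)).

Lemma gp_path_cons j b (a : A (source b)) (p : apath A j (target b)) :
  gp_path (APcons a p) = gp_vertex a * gp_arrow b * gp_path p.
Proof.
by rewrite /gp_vertex /gp_arrow !gp_path_mul /= mulr1 apath_lmul1.
Qed.

Lemma gp_vertex_linear i : linear (@gp_vertex i).
Proof. by move=> c x y; apply: gp_path_lin; constructor. Qed.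

Lemma gp_vertexZ i c (a : A i) : gp_vertex (c *: a) = c *: gp_vertex a.
Proof. exact: linearZ_LR (linear_of (@gp_vertex_linear i)) c a. Qed.

Lemma gp_vertexM i (a b : A i) : gp_vertex a * gp_vertex b = gp_vertex (a * b).
Proof. exact: gp_path_mul. Qed.

Lemma gp_vertex_orth i j (a : A i) (b : A j) :
  i != j -> gp_vertex a * gp_vertex b = 0.
Proof. exact: gp_path_mul0. Qed.

Lemma gp_vertex_arrow b :
  gp_vertex (1 : A (source b)) * gp_arrow b = gp_arrow b.
Proof. by rewrite /gp_vertex /gp_arrow gp_path_mul /= mul1r. Qed.

Lemma gp_arrow_vertex b :
  gp_arrow b * gp_vertex (1 : A (target b)) = gp_arrow b.
Proof. by rewrite /gp_vertex /gp_arrow gp_path_mul /= mul1r. Qed.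

Lemma gp_sum_vertex : \sum_i gp_vertex (1 : A i) = 1.
Proof. by rewrite gp_path1. Qed.

Lemma gp_class_linear : linear (@gp_class k Q A).
Proof.
move=> c x y; rewrite raddfD /=; congr (_ + _).
by rewrite -gp_class_scale.
Qed.

Lemma gp_linear_ind (D : L -> Prop) :
  D 0 -> (forall c x y, D x -> D y -> D (c *: x + y)) ->
  (forall j i (p : apath A j i), D (gp_path p)) -> forall x, D x.
Proof.
move=> D0 DL Dp x; rewrite -[x]gp_reprK.
elim/freeg_ind1: (gp_repr x) => [|c y z Hy Hz|[i j p]]; last exact: Dp.
- by rewrite raddf0.
- by rewrite gp_class_linear; apply: DL.
Qed.

(** Every A-path factors, by [gp_path_cons], into elements of the vertex algebras and arrows, so
    these generate [L] as a ring. *)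
Lemma gp_ring_ind (D : L -> Prop) :
  D 0 -> (forall x y, D x -> D y -> D (x + y)) ->
  (forall x y, D x -> D y -> D (x * y)) ->
  (forall i (a : A i), D (gp_vertex a)) -> (forall b, D (gp_arrow b)) ->
  forall x, D x.
Proof.
move=> D0 DD DM Dv Da; apply: gp_linear_ind => // [c x y Dx Dy|j i p].
  (* The scalar [c] is itself a ring element, the sum of the elements [gp_vertex (c *: 1)]. *)
  apply: (DD) => //; rewrite -[x]mulr1 gp_scaleAr; apply: (DM) => //.
  rewrite -gp_sum_vertex scaler_sumr; elim/big_rec: _ => // i z _ Dz.
  by apply: (DD) => //; rewrite -gp_vertexZ.
elim: p => [a|b a p IH]; first exact: Dv.
by rewrite gp_path_cons; do ?apply: (DM).
Qed.

Lemma gp_mul_linearl (y : L) : linear (fun x : L => x * y).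
Proof. by move=> c x z; rewrite mulrDl gp_scaleAl. Qed.

Lemma gp_mul_linearr (x : L) : linear (fun y : L => x * y).
Proof. by move=> c y z; rewrite mulrDr gp_scaleAr. Qed.

(** Acyclicity bounds the length of paths, and each entry only needs to run through a basis of its
    vertex algebra, which leaves finitely many products. *)
Lemma gp_spans : acyclic Q -> exists s : seq L, forall x, spans s x.
Proof.
move=> aQ.
pose s0 : seq L :=
  flatten [seq [seq gp_vertex b | b <- vbasis {:A i}] | i : vertex Q].
have s0P i (a : A i) : spans s0 (gp_vertex a).
  rewrite (coord_vbasis (memvf a)).
  elim/big_rec: _ => [|l x _ IH].
    by rewrite (linear_fun0 (@gp_vertex_linear i)); constructor.
  rewrite gp_vertex_linear; apply: spans_linear => //; apply: spans_mem.
  apply/flatten_mapP; exists i; first by rewrite mem_enum.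
  by apply: map_f; apply: mem_nth; rewrite size_tuple.
pose s1 : seq L := [seq gp_arrow b | b : arrow Q].
have bound n : exists s : seq L, forall j i (p : apath A j i),
    (size (apath_arrows p) <= n)%N -> spans s (gp_path p).
  elim: n => [|n [s Hs]].
    by exists s0 => j i [a|//] _; apply: s0P.
  exists (s0 ++ [seq x * y | x <- [seq x * y | x <- s0, y <- s1], y <- s]).
  move=> j i [a|b a p] /= pn.
    by apply: spans_sub (s0P _ a) => x; rewrite mem_cat => ->.
  have sub (t : seq L) : {subset t <= s0 ++ t}.
    by move=> x; rewrite mem_cat orbC => ->.
  apply: (spans_sub (@sub _)); rewrite gp_path_cons.
  apply: (spans_bilinear gp_mul_linearl gp_mul_linearr); last exact: Hs.
  apply: (spans_bilinear gp_mul_linearl gp_mul_linearr) => //.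
  by apply: spans_mem; apply: (map_f gp_arrow); rewrite mem_enum.
have [s Hs] := bound #|arrow Q|; exists s; apply: gp_linear_ind.
- by constructor.
- by move=> c x y; apply: spans_linear.
- by move=> j i p; apply/Hs/size_apath_arrows.
Qed.

Local Notation "[ 'res' M ]" := (restrict (gp_scalars A) M : lmodType k).

Lemma gp_scalar_mull c (x : L) : (gp_scalars A c : L) * x = c *: x.
Proof. by rewrite -gp_scaleAl mul1r. Qed.

Lemma gp_scalar_central c (x : L) :
  (x : L^c) * gp_scalars A c = gp_scalars A c * (x : L^c).
Proof.
rewrite -[LHS]/((gp_scalars A c : L) * x) gp_scalar_mull.
by rewrite -[RHS]/(x * (c *: (1 : L))) -gp_scaleAr mulr1.
Qed.

Lemma gp_act_linear (M : rmodType L) (x : L^c) :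
  linear (fun y : [res M] => (x *: (y : M) : [res M])).
Proof.
move=> c y z; rewrite scalerDr !restrictE !scalerA.
by rewrite (gp_scalar_central c (x : L)).
Qed.

Lemma gp_act_linearl (M : rmodType L) (y : M) :
  linear (fun x : L => ((x : L^c) *: y : [res M])).
Proof.
move=> c x z; rewrite -(gp_scalar_mull c x) scalerDl restrictE scalerA.
by rewrite -(gp_scalar_central c x).
Qed.

Lemma gp_fin_dim (M : rmodType L) :
  acyclic Q -> fin_generated M -> fin_dim [res M].
Proof.
move=> /gp_spans [s Hs] [t Ht].
pose f (x : L) (y : [res M]) : [res M] := (x : L^c) *: (y : M).
apply: (fin_dim_spans (s := [seq f x y | x <- s, y <- t])) => x.
have [c ->] := Ht x; elim/big_ind: _ => [|y z sy sz|i _]; first exact: spans0.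
  exact: (@spans_add _ [res M]).
apply: (@spans_bilinear _ _ _ _ f); last first.
- by apply/spans_mem/mem_nth.
- exact: Hs.
- exact: gp_act_linear.
- exact: gp_act_linearl.
Qed.

(** The elements of [L] whose action [f] respects are closed under sums and products, so the
    generators of [gp_ring_ind] suffice. *)
Lemma gp_linear (M N : rmodType L) (f : M -> N) :
  (forall x y, f (x + y) = f x + f y) ->
  (forall i (a : A i) x,
    f ((gp_vertex a : L^c) *: x) = (gp_vertex a : L^c) *: f x) ->
  (forall b x, f ((gp_arrow b : L^c) *: x) = (gp_arrow b : L^c) *: f x) ->
  linear f.
Proof.
move=> fD fv fa; suff fZ (l : L) x : f ((l : L^c) *: x) = (l : L^c) *: f x.
  by move=> l x y; rewrite fD fZ.
have f0 : f 0 = 0 by apply: (addrI (f 0)); rewrite -fD !addr0.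
elim/gp_ring_ind: l x => [x|l m Hl Hm x|l m Hl Hm x||] //.
- by rewrite !scale0r.
- by rewrite !scalerDl fD Hl Hm.
- by rewrite -[l * m]/((m : L^c) * (l : L^c)) -!scalerA Hm Hl.
Qed.

End Generators.

(** * Parts of modules at a vertex, modules concentrated at a vertex, twists *)

(* The right action of the algebra on its right modules. *)
Notation "x |> l" := ((l : (gp_algebra _)^c) *: x)
  (at level 40, left associativity, only parsing).

Section VertexPart.
Variables (k : fieldType) (Q : quiver) (A : vertex Q -> falgType k).
Local Notation L := (gp_algebra A).
Implicit Types X Y Z : rmodType L.

Lemma gp_actM X (x : X) (l m : L) : x |> l |> m = x |> (l * m).
Proof. by rewrite scalerA. Qed.

Lemma gp_mapZ X Y (f : {linear X -> Y}) (x : X) (l : L) :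
  f (x |> l) = f x |> l.
Proof. exact: linearZ_LR. Qed.

Section Part.
Variables (i : vertex Q) (X : rmodType L).

Definition vpart_pred : {pred X} := fun x => x |> gp_vertex (1 : A i) == x.

Lemma vpart_zmod_closed : zmod_closed vpart_pred.
Proof.
split=> [|x y]; rewrite !unfold_in ?scaler0 // => /eqP ex /eqP ey.
by rewrite scalerBr ex ey.
Qed.

HB.instance Definition _ :=
  GRing.isZmodClosed.Build X vpart_pred vpart_zmod_closed.

Record vpart := Vpart { vval : X; _ : vval \in vpart_pred }.

HB.instance Definition _ := [isSub for vval].
HB.instance Definition _ := [Choice of vpart by <:].
HB.instance Definition _ := [SubChoice_isSubZmodule of vpart by <:].

Lemma vvalP (x : vpart) : vval x |> gp_vertex (1 : A i) = vval x.
Proof. by apply/eqP; case: x. Qed.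

Lemma vact_subproof (x : X) (a : A i) : x |> gp_vertex a \in vpart_pred.
Proof. by rewrite unfold_in gp_actM gp_vertexM mulr1. Qed.

Definition vact (a : (A i)^c) (x : vpart) : vpart :=
  Vpart (vact_subproof (vval x) a).

Lemma vactA a b x : vact a (vact b x) = vact (a * b) x.
Proof. by apply: val_inj; rewrite /= gp_actM gp_vertexM. Qed.

Lemma vact1 : left_id 1 vact.
Proof. by move=> x; apply: val_inj; rewrite /= vvalP. Qed.

Lemma vactDr : right_distributive vact +%R.
Proof. by move=> a x y; apply: val_inj; rewrite /= scalerDr. Qed.

Lemma vactDl x : {morph vact^~ x : a b / a + b}.
Proof.
move=> a b; apply: val_inj; rewrite /= -scalerDl; congr (_ *: _).
by rewrite -[a]scale1r gp_vertex_linear !scale1r.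
Qed.

HB.instance Definition _ :=
  GRing.Zmodule_isLmodule.Build (A i)^c vpart vactA vact1 vactDr vactDl.

Lemma vvalD (x y : vpart) : vval (x + y) = vval x + vval y.
Proof. by []. Qed.

Lemma vvalZ (a : A i) (x : vpart) :
  vval ((a : (A i)^c) *: x) = vval x |> gp_vertex a.
Proof. by []. Qed.

Definition vproj (x : X) : vpart := Vpart (vact_subproof x 1).

Lemma vvalK : cancel vval vproj.
Proof. by move=> x; apply: val_inj; rewrite /= vvalP. Qed.

Lemma vprojD x y : vproj (x + y) = vproj x + vproj y.
Proof. by apply: val_inj; rewrite /= scalerDr. Qed.

Lemma vproj_act (a : A i) x :
  vproj (x |> gp_vertex a) = (a : (A i)^c) *: vproj x.
Proof. by apply: val_inj; rewrite /= !gp_actM !gp_vertexM mul1r mulr1. Qed.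

Lemma vproj_restrict_linear : linear (vproj
  : restrict (gp_scalars A) X -> restrict (alg_scalars (A i)) vpart).
Proof.
move=> c x y; rewrite !restrictE vprojD; congr (_ + _); apply: val_inj.
rewrite /= !gp_actM; congr (_ *: _).
by rewrite gp_vertexM mul1r gp_vertexZ gp_scalar_mull.
Qed.

End Part.

Lemma vproj_act0 X i j (a : A j) (x : X) :
  j != i -> vproj i (x |> gp_vertex a) = 0.
Proof.
by move=> ji; apply: val_inj; rewrite /= gp_actM gp_vertex_orth // scale0r.
Qed.

Lemma sum_vproj X (x : X) : \sum_i vval (vproj i x) = x.
Proof. by rewrite -scaler_suml gp_sum_vertex scale1r. Qed.

(** The detour through k: [X] has finite dimension by [gp_fin_dim], and its part at [i] is a
    k-linear image of it. *)
Lemma vpart_fin_generated X i :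
  acyclic Q -> fin_generated X -> fin_generated (vpart i X : rmodType (A i)).
Proof.
move=> aQ /(gp_fin_dim aQ) Xf.
apply: (restrict_fin_generated (phi := alg_scalars (A i))).
apply: fin_dim_surj (@vproj_restrict_linear i X) _ Xf => y.
by exists (vval y); exact: vvalK.
Qed.

Section Map.
Variables (X Y : rmodType L) (f : {linear X -> Y}) (i : vertex Q).

Definition vmap_fun (x : vpart i X) : vpart i Y := vproj i (f (vval x)).

Lemma vval_vmap_fun x : vval (vmap_fun x) = f (vval x).
Proof. by rewrite /= -gp_mapZ vvalP. Qed.

Lemma vmap_linear : linear vmap_fun.
Proof.
move=> a x y; apply: val_inj; rewrite [LHS]vval_vmap_fun [RHS]vvalD vvalZ.
by rewrite !vval_vmap_fun -gp_mapZ -linearD.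
Qed.

Definition vmap : {linear vpart i X -> vpart i Y} := linear_of vmap_linear.

Lemma vval_vmap x : vval (vmap x) = f (vval x).
Proof. exact: vval_vmap_fun. Qed.

Lemma vmap_surj :
  (forall y, exists x, f x = y) -> forall y, exists x, vmap x = y.
Proof.
move=> fS y; have [x xE] := fS (vval y); exists (vproj i x).
by apply: val_inj; rewrite [LHS]vval_vmap /= gp_mapZ xE vvalP.
Qed.

End Map.

Lemma vpart_short_exact X Y Z (i : {linear X -> Y}) (e : {linear Y -> Z}) j :
  short_exact i e -> short_exact (vmap i j) (vmap e j).
Proof.
move=> [iI eS ex]; split; last 1 first.
- move=> x; split=> [/(congr1 (@vval _ _))|[y <-]].
    (* The preimage [y] need not lie in the part at [j]; its projection does and has the same
       image. *)
    rewrite vval_vmap => /ex [y yE]; exists (vproj j y); apply: val_inj.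
    by rewrite [LHS]vval_vmap /= gp_mapZ yE vvalP.
  apply: val_inj; rewrite [LHS]vval_vmap vval_vmap.
  by apply/ex; exists (vval y).
- move=> x y /(congr1 (@vval _ _)); rewrite !vval_vmap => /iI.
  exact: val_inj.
- exact: vmap_surj.
Qed.

End VertexPart.

(** * Modules concentrated at a vertex *)

Section Concentrated.
Variables (k : fieldType) (Q : quiver) (A : vertex Q -> falgType k).
Local Notation L := (gp_algebra A).

(* The projection onto the factor [A j] of the product of the [A i]. *)
Definition vertex_coord j i (a : A i) : A j :=
  if i =P j is ReflectT e then ecast l (A l) e a else 0.

Lemma vertex_coord_id j (a : A j) : vertex_coord j a = a.
Proof. by rewrite /vertex_coord; case: eqP => // e; rewrite eq_axiomK. Qed.

Lemma vertex_coord0 j i (a : A i) : i != j -> vertex_coord j a = 0.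
Proof. by rewrite /vertex_coord; case: eqP. Qed.

Lemma vertex_coord_linear j i : linear (@vertex_coord j i).
Proof.
move=> c a b; have [e|n] := eqVneq i j; last first.
  by rewrite !vertex_coord0 // scaler0 addr0.
by subst j; rewrite !vertex_coord_id.
Qed.

Lemma vertex_coordM j i (a b : A i) :
  vertex_coord j (a * b) = vertex_coord j a * vertex_coord j b.
Proof.
have [e|n] := eqVneq i j; last by rewrite !vertex_coord0 // mul0r.
by subst j; rewrite !vertex_coord_id.
Qed.

Lemma vertex_coord_orth j i l (a : A i) (b : A l) : i != l ->
  vertex_coord j a * vertex_coord j b = 0.
Proof.
move=> il; have [e|n] := eqVneq i j; last by rewrite vertex_coord0 // mul0r.
by rewrite [vertex_coord j b]vertex_coord0 ?mulr0 // -e eq_sym.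
Qed.

Section Module.
Variables (j : vertex Q) (M : rmodType (A j)).

Local Notation U := (restrict (alg_scalars (A j)) M : lmodType k).

Definition conc_alg i (a : A i) (u : U) : U :=
  (vertex_coord j a : (A j)^c) *: (u : M).

Definition conc_arrow (b : arrow Q) (u : U) : U := 0.

Lemma conc_alg_linearl i u : linear (fun a : A i => conc_alg a u).
Proof.
move=> c a b; rewrite /conc_alg vertex_coord_linear.
set x := vertex_coord j a; set y := vertex_coord j b.
have -> : (c *: x + y : (A j)^c) = alg_scalar (A j) c * (x : (A j)^c) + y.
  by congr (_ + _); rewrite -[RHS]/(x * c%:A) -scalerAr mulr1.
by rewrite scalerDl restrictE scalerA.
Qed.

Lemma conc_alg_linearr i (a : A i) : linear (conc_alg a).
Proof.
move=> c u v; rewrite /conc_alg scalerDr !restrictE !scalerA.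
set x := vertex_coord j a.
have -> : (x : (A j)^c) * alg_scalar (A j) c
    = alg_scalar (A j) c * (x : (A j)^c).
  rewrite -[LHS]/(c%:A * x) -[RHS]/(x * c%:A).
  by rewrite -scalerAr mulr1 -scalerAl mul1r.
by [].
Qed.

Lemma conc_arrow_linear b : linear (conc_arrow b).
Proof. by move=> c u v; rewrite /conc_arrow scaler0 addr0. Qed.

Lemma conc_algM i (a b : A i) u :
  conc_alg (a * b) u = conc_alg b (conc_alg a u).
Proof. by rewrite /conc_alg vertex_coordM scalerA. Qed.

Lemma conc_alg0 i l (a : A i) (b : A l) u : i != l ->
  conc_alg b (conc_alg a u) = 0.
Proof.
move=> il; rewrite /conc_alg scalerA.
have -> : (vertex_coord j b : (A j)^c) * (vertex_coord j a : (A j)^c) = 0.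
  exact: vertex_coord_orth.
by rewrite scale0r.
Qed.

Lemma conc_alg1 u : \sum_i conc_alg (1 : A i) u = u.
Proof.
rewrite (bigD1 j) //= big1 => [|i ij].
  by rewrite addr0 /conc_alg vertex_coord_id scale1r.
by rewrite /conc_alg vertex_coord0 // scale0r.
Qed.

Definition conc_rep : gp_rep A := GPRep conc_alg_linearl conc_alg_linearr
  conc_arrow_linear conc_algM conc_alg0 conc_alg1.

Definition conc : rmodType L := rep_mod conc_rep.

Lemma conc_vertexE i (a : A i) (u : conc) :
  u |> gp_vertex a = (vertex_coord j a : (A j)^c) *: (u : M).
Proof. exact: (rep_modE (r := conc_rep)). Qed.

Lemma conc_arrowE b (u : conc) : u |> gp_arrow A b = 0.
Proof.
rewrite /gp_arrow (rep_modE (r := conc_rep)).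
exact: linear_fun0 (conc_alg_linearr _).
Qed.

Lemma conc_scale c (u : conc) :
  c *: (u : restrict (gp_scalars A) conc) = c *: (u : U) :> U.
Proof. exact: (rep_mod_scale (r := conc_rep)). Qed.

Lemma conc_fin_generated : fin_generated M -> fin_generated conc.
Proof.
move=> [s Hs]; exists s => x; have [c xE] := Hs x.
exists (fun i => gp_vertex (c i : A j)); rewrite [LHS]xE.
by apply: eq_bigr => i _; rewrite conc_vertexE vertex_coord_id.
Qed.

(** The way back from [L] to [A j]: [vval] and [vproj] identify the part of [conc] at [j] with
    [M]. *)
Lemma vpart_conc_pdle n : pdle n (vpart j conc) -> pdle n M.
Proof.
have lf : linear (@vval _ _ _ j conc : vpart j conc -> M).
  move=> a x y; rewrite vvalD; congr (_ + _).
  by rewrite vvalZ conc_vertexE vertex_coord_id.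
have vvK (u : M) : vval (@vproj _ _ _ j conc u) = u.
  by rewrite /= conc_vertexE vertex_coord_id scale1r.
have lg : linear (@vproj _ _ _ j conc : M -> vpart j conc).
  move=> a x y; apply: val_inj.
  by rewrite [LHS]vvK [RHS]lf !vvK.
apply: (pdle_iso (f := linear_of lf) (g := linear_of lg)) => x.
  exact: vvalK.
exact: vvK.
Qed.

End Module.

Lemma conc_linear j (M N : rmodType (A j)) (f : {linear M -> N}) :
  linear (f : conc M -> conc N).
Proof.
apply: gp_linear => [x y|i a x|b x]; first exact: linearD.
  by rewrite !conc_vertexE linearZ_LR.
by rewrite !conc_arrowE linear0.
Qed.

End Concentrated.

(** * Twisted extensions *)

Section Twist.
Variables (k : fieldType) (Q : quiver) (A : vertex Q -> falgType k).
Local Notation L := (gp_algebra A).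
Local Notation "[ 'res' M ]" := (restrict (gp_scalars A) M : lmodType k).

Lemma vertex_act_linearl (M : rmodType L) i (u : M) :
  linear (fun a : A i => (u |> gp_vertex a : [res M])).
Proof.
move=> c a b; rewrite gp_vertex_linear.
exact: (@gp_act_linearl _ _ _ M).
Qed.

Section TwistDef.
Variables (M P : rmodType L) (psi : arrow Q -> P -> M).
Hypothesis psi_linear : forall b, linear (psi b : [res P] -> [res M]).

Local Notation U := ([res M] * [res P])%type.

Definition twist_alg i (a : A i) (u : U) : U :=
  ((u.1 : M) |> gp_vertex a, (u.2 : P) |> gp_vertex a).

(** The off-diagonal term [psi b] gives an extension of [P] by [M]. Any k-linear [psi b] is
    admissible, since [gp_rep] asks only k-linearity of an arrow. *)
Definition twist_arrow b (u : U) : U :=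
  ((u.1 : M) |> gp_arrow A b + psi b u.2, (u.2 : P) |> gp_arrow A b).

Lemma twist_alg_linearl i u : linear (fun a : A i => twist_alg a u).
Proof.
by move=> c a b; congr pair; apply: (@vertex_act_linearl _ i).
Qed.

Lemma twist_alg_linearr i (a : A i) : linear (twist_alg a).
Proof. by move=> c u v; congr pair; apply: gp_act_linear. Qed.

Lemma twist_arrow_linear b : linear (twist_arrow b).
Proof.
move=> c u v; congr pair; last exact: gp_act_linear.
rewrite /= psi_linear (gp_act_linear (M := M)).
by rewrite addrACA; congr (_ + _); exact: (esym (scalerDr _ _ _)).
Qed.

Lemma twist_algM i (a b : A i) u :
  twist_alg (a * b) u = twist_alg b (twist_alg a u).
Proof. by rewrite /twist_alg /= !gp_actM gp_vertexM. Qed.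

Lemma twist_alg0 i j (a : A i) (b : A j) u : i != j ->
  twist_alg b (twist_alg a u) = 0.
Proof.
by move=> ij; rewrite /twist_alg /= !gp_actM gp_vertex_orth // !scale0r.
Qed.

Lemma twist_alg1 u : \sum_i twist_alg (1 : A i) u = u.
Proof.
case: u => x y.
transitivity (\sum_i vval (vproj i (x : M)), \sum_i vval (vproj i (y : P))).
  by elim/big_rec3: _ => // i u v w _ ->.
by rewrite !sum_vproj.
Qed.

Definition twist_rep : gp_rep A := GPRep twist_alg_linearl twist_alg_linearr
  twist_arrow_linear twist_algM twist_alg0 twist_alg1.

Definition twist : rmodType L := rep_mod twist_rep.

Lemma twist_vertexE i (a : A i) (u : twist) :
  u |> gp_vertex a = twist_alg a u.
Proof. exact: (rep_modE (r := twist_rep)). Qed.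

(** [gp_arrow A b] is the A-path with entry 1 on both sides of [b], so [psi b] appears between the
    idempotents of the source and the target. *)
Lemma twist_arrowE b (u : twist) : u |> gp_arrow A b =
  (u.1 |> gp_arrow A b
   + psi b (u.2 |> gp_vertex (1 : A (source b)))
     |> gp_vertex (1 : A (target b)),
   u.2 |> gp_arrow A b).
Proof.
rewrite {1}/gp_arrow (rep_modE (r := twist_rep)) /= /twist_alg /twist_arrow /=.
by rewrite scalerDr !gp_actM !(gp_vertex_arrow, gp_arrow_vertex, mulrA).
Qed.

End TwistDef.
End Twist.

(** * Projective modules over a generalized path algebra *)

Section Projectives.
Variables (k : fieldType) (Q : quiver) (A : vertex Q -> falgType k).
Local Notation L := (gp_algebra A).
Local Notation "[ 'res' M ]" := (restrict (gp_scalars A) M : lmodType k).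
Implicit Types M N P X Y F : rmodType L.

(** A scalar [c] acts as the sum of the elements [gp_vertex (c *: 1)], with each of which [f]
    commutes. *)
Lemma vertex_linear_restrict M N (f : M -> N) :
  (forall x y, f (x + y) = f x + f y) ->
  (forall i (a : A i) x, f (x |> gp_vertex a) = f x |> gp_vertex a) ->
  linear (f : [res M] -> [res N]).
Proof.
move=> fD fv; have f0 : f 0 = 0 by apply: (addrI (f 0)); rewrite -fD !addr0.
move=> c x y; rewrite fD !restrictE; congr (_ + _).
have -> : gp_scalars A c = \sum_i gp_vertex (c *: (1 : A i)) :> L.
  rewrite /= /gp_scalar -gp_sum_vertex scaler_sumr.
  by apply: eq_bigr => i _; rewrite gp_vertexZ.
rewrite !scaler_suml (big_morph f fD f0).
by apply: eq_bigr => i _; exact: fv.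
Qed.

(** The hypotheses on [theta] make [x] mapped to [(theta x, x)] linear into the twist by [g \o psi].
    Projectivity lifts this map to the twist by [psi], and [phi] is the first component of the
    lift. *)
Lemma twisted_lift P M N (g : {linear M -> N}) (psi : arrow Q -> P -> M)
    (theta : P -> N) :
  projective P -> (forall y, exists x, g x = y) ->
  (forall b, linear (psi b : [res P] -> [res M])) ->
  (forall x y, theta (x + y) = theta x + theta y) ->
  (forall i (a : A i) x, theta (x |> gp_vertex a) = theta x |> gp_vertex a) ->
  (forall b x, theta (x |> gp_arrow A b) = theta x |> gp_arrow A b
     + g (psi b (x |> gp_vertex (1 : A (source b))))
       |> gp_vertex (1 : A (target b))) ->
  exists phi : P -> M,
    [/\ forall x y, phi (x + y) = phi x + phi y,
        forall i (a : A i) x, phi (x |> gp_vertex a) = phi x |> gp_vertex a,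
        forall b x, phi (x |> gp_arrow A b) = phi x |> gp_arrow A b
          + psi b (x |> gp_vertex (1 : A (source b)))
            |> gp_vertex (1 : A (target b))
      & forall x, g (phi x) = theta x].
Proof.
move=> Pp gS lpsi thD thv tha.
have lgpsi b : linear (g \o psi b : [res P] -> [res N]).
  by move=> c x y; rewrite /= lpsi linearP.
pose E := twist lpsi; pose E' := twist lgpsi.
have lG : linear (fun u : E => (g u.1, u.2) : E').
  apply: gp_linear => [u v|i a u|b u].
  - by rewrite linearD.
  - by rewrite !twist_vertexE /twist_alg /= gp_mapZ.
  - by rewrite !twist_arrowE /= linearD !gp_mapZ.
have lT : linear (fun x : P => (theta x, x) : E').
  apply: gp_linear => [x y|i a x|b x].
  - by rewrite thD.
  - by rewrite twist_vertexE /twist_alg /= thv.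
  - by rewrite twist_arrowE /= tha.
have GS (y : E') : exists x, linear_of lG x = y.
  by case: y => y z; have [x xE] := gS y; exists (x, z); rewrite /= xE.
have [h Hh] := projective_lift Pp lT GS.
have h2 x : (h x).2 = x by have [] := Hh x.
have h1 x : g (h x).1 = theta x by have [] := Hh x.
exists (fun x => (h x).1); split=> // [x y|i a x|b x].
- by rewrite linearD.
- by rewrite gp_mapZ twist_vertexE.
- by rewrite gp_mapZ twist_arrowE /= h2.
Qed.

(** Only the arrow actions are twisted in [twisted_lift], so the resulting [phi] is linear over
    [A j]. It suffices to view [f], extended to [P] by [vproj], as a twisted map into [conc N]. *)
Lemma vpart_projective P j :
  fin_dim [res P] -> projective P -> projective (vpart j P).
Proof.
move=> Pf Pp M N g f gS.
have lg : linear (g : restrict (alg_scalars (A j)) M ->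
                  restrict (alg_scalars (A j)) N).
  by apply: restrict_linear => a x y; rewrite linearP.
have lf : linear (f \o @vproj _ _ _ j P :
                  [res P] -> restrict (alg_scalars (A j)) N).
  by move=> c x y; rewrite /= vproj_restrict_linear !restrictE linearP.
have [s ls Hs] := fin_dim_lift lg lf gS Pf.
(* Arrows act as zero on [conc N], while [theta] need not vanish on [x |> gp_arrow A b]; [psi b]
   accounts for that value through the k-linear lift [s]. *)
pose psi b (x : P) : conc M := s (x |> gp_arrow A b).
have lpsi b : linear (psi b : [res P] -> [res (conc M)]).
  by move=> c x y; rewrite /psi (gp_act_linear (M := P)) ls conc_scale.
pose theta (x : P) : conc N := f (vproj j x).
pose gc := linear_of (conc_linear g).
have [| | |i a x|b x|phi [phD phv _ Hphi]] :=
  @twisted_lift P _ _ gc psi theta Pp.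
- exact: gS.
- exact: lpsi.
- by move=> x y; rewrite /theta vprojD linearD.
- rewrite /theta conc_vertexE; have [ij|ij] := eqVneq i j.
    by subst i; rewrite vertex_coord_id vproj_act linearZ_LR.
  by rewrite vproj_act0 // linear0 vertex_coord0 // scale0r.
- rewrite conc_arrowE add0r conc_vertexE /= /psi.
  rewrite gp_actM gp_vertex_arrow [g _]Hs /=.
  (* For an arrow not ending at [j] both sides vanish. *)
  have [tj|tj] := eqVneq (target b) j.
    by subst j; rewrite vertex_coord_id scale1r.
  rewrite /theta -gp_arrow_vertex -gp_actM vproj_act0 //.
  by rewrite linear0 vertex_coord0 // scale0r.
have lh : linear (fun y : vpart j P => phi (vval y) : M).
  move=> a x y; rewrite vvalD vvalZ phD phv conc_vertexE.
  by rewrite vertex_coord_id.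
by exists (linear_of lh) => y; rewrite [LHS]Hphi /theta vvalK.
Qed.

Lemma submodule_projective Y F (j : {linear Y -> F}) :
  injective j -> fin_dim [res F] -> projective F ->
  (forall i, projective (vpart i Y)) -> projective Y.
Proof.
move=> jI Ff Fp Yp M N g f gS.
(* The maps induced by [f] on the parts lift vertex by vertex; the sum [h] of these lifts respects
   the vertex algebras but perhaps not the arrows. *)
pose h_ i := sval (cid (Yp i _ _ (vmap g i) (vmap f i) (vmap_surj gS))).
have Hh_ i y : g (vval (h_ i y)) = f (vval y).
  rewrite -vval_vmap -[RHS]vval_vmap; congr (vval _).
  exact: (svalP (cid (Yp i _ _ (vmap g i) (vmap f i) (vmap_surj gS)))).
pose h (y : Y) : M := \sum_i vval (h_ i (vproj i y)).
have hD x y : h (x + y) = h x + h y.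
  by rewrite -big_split; apply: eq_bigr => i _; rewrite vprojD linearD.
have hv l (a : A l) y : h (y |> gp_vertex a) = h y |> gp_vertex a.
  rewrite /h scaler_sumr; apply: eq_bigr => i _.
  have [il|il] := eqVneq l i.
    by subst l; rewrite vproj_act linearZ_LR vvalZ.
  rewrite vproj_act0 // linear0 -[vval (h_ i _) in RHS]vvalP gp_actM.
  by rewrite gp_vertex_orth 1?eq_sym // scale0r.
have gh y : g (h y) = f y.
  rewrite linear_sum -[in RHS](sum_vproj y) linear_sum.
  by apply: eq_bigr => i _; rewrite Hh_.
have lj : linear (j : [res Y] -> [res F]).
  by apply: restrict_linear => a x y; rewrite linearP.
(* The k-linear retraction [r] extends the defect [d b] of [h] at the arrows from [Y] to all of
   [F]. *)
have [r lr rK] := fin_dim_retraction lj jI Ff.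
pose d b (y : Y) : M := h (y |> gp_arrow A b) - h y |> gp_arrow A b.
have lhr := vertex_linear_restrict hD hv.
have ld b : linear (d b : [res Y] -> [res M]).
  move=> c x y; rewrite /d (gp_act_linear (M := Y)) !lhr.
  rewrite (gp_act_linear (M := M)).
  by rewrite opprD addrACA -scalerBr.
have lpsi b : linear ((fun x => d b (r x)) : [res F] -> [res M]).
  by move=> c x y; rewrite lr ld.
have gd b y : g (d b y) = 0 by rewrite linearB gp_mapZ !gh gp_mapZ subrr.
(* Over the zero map the twisted lift [phi] takes values in the kernel of [g]. Subtracting
   [phi \o j] from [h] therefore still lifts [f], and it cancels the defect. *)
have [| | |phi [phD phv pha gphi]] :=
  @twisted_lift F _ _ g _ (fun=> 0) Fp gS lpsi.
- by move=> x y; rewrite addr0.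
- by move=> i a x; rewrite scaler0.
- by move=> b x; rewrite gd !scaler0 addr0.
have lk : linear (fun y => h y - phi (j y)).
  apply: gp_linear => [x y|i a x|b x].
  - by rewrite hD linearD phD opprD addrACA.
  - by rewrite hv gp_mapZ phv scalerBr.
  have dE : d b (x |> gp_vertex (1 : A (source b)))
      |> gp_vertex (1 : A (target b))
      = h (x |> gp_arrow A b) - h x |> gp_arrow A b.
    rewrite /d hv !gp_actM gp_vertex_arrow scalerBr -hv !gp_actM.
    by rewrite gp_arrow_vertex.
  rewrite gp_mapZ pha -gp_mapZ rK dE scalerBr opprD opprB.
  by rewrite addrCA [X in _ + X]addrC subrK addrC.
exists (linear_of lk) => y /=.
by rewrite linearB gh gphi subr0.
Qed.

Lemma conc_not_projective b :
  ~ projective (conc (((A (source b))^c)^o : rmodType (A (source b)))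
                : rmodType L).
Proof.
set s := source b; set t := target b => Pp.
pose M : rmodType (A s) := ((A s)^c)^o; pose N : rmodType (A t) := ((A t)^c)^o.
(* A coordinate that is nonzero at 1 provides a k-linear map [lam] with [lam 1] nonzero. *)
have [i ci] : exists i, coord (vbasis {: A s}) i 1 != 0.
  apply: contrapT => H; have /eqP := oner_neq0 (A s); apply.
  rewrite (coord_vbasis (memvf 1)) big1 // => i _.
  have -> : coord (vbasis {: A s}) i 1 = 0; last by rewrite scale0r.
  by apply: contrapT => /eqP ci; apply: H; exists i.
pose lam (x : A s) : A t := coord (vbasis {: A s}) i x *: 1.
have llam : linear lam by move=> c x y; rewrite /lam linearP scalerDl scalerA.
pose psi (_ : arrow Q) : (conc M : rmodType L) -> (conc N : rmodType L) := lam.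
(* With the zero module as codomain of [g] and [theta], the conditions on them are trivial, and what
   remains is the twisted relation for [phi]. *)
pose Z : rmodType L := 'rV[L^c]_0.
have Z0 (x y : Z) : x = y by apply/rowP => -[].
have lg : linear (fun _ : (conc N : rmodType L) => 0 : Z).
  by move=> a x y; apply: Z0.
have [|c|||b' x|phi [phD _ phb _]] :=
  @twisted_lift _ _ _ (linear_of lg) psi (fun=> 0) Pp.
- by move=> y; exists 0; apply: Z0.
- move=> a x y; rewrite !conc_scale.
  have regE (u : vertex Q) (z : A u) :
      a *: (z : restrict (alg_scalars (A u)) ((A u)^c)^o) = a *: z :> A u.
    by rewrite -[LHS]/(z * a%:A) -scalerAr mulr1.
  by rewrite /psi !regE llam.
- by move=> *; apply: Z0.
- by move=> *; apply: Z0.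
- by apply: Z0.
have ph0 : phi 0 = 0 by apply: (addrI (phi 0)); rewrite -phD !addr0.
(* Arrows act as zero on both concentrated modules, so at 1 the relation reads [lam 1 = 0]. *)
have := phb b (1 : A s); rewrite !conc_arrowE ph0 add0r !conc_vertexE.
rewrite !vertex_coord_id !scale1r => /esym/eqP.
rewrite /psi -[_ == _]/(lam 1 == 0) /lam scaler_eq0 oner_eq0 orbF.
by apply/negP.
Qed.

End Projectives.

(** * Global dimension *)

Section GlobalDimension.
Variables (k : fieldType) (Q : quiver) (A : vertex Q -> falgType k).
Local Notation L := (gp_algebra A).
Hypothesis aQ : acyclic Q.
Implicit Types X : rmodType L.

Lemma vpart_fg_projective X j : fin_generated X -> projective X ->
  fin_generated (vpart j X : rmodType (A j)) /\ projective (vpart j X).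
Proof.
move=> Xf Xp; split; first exact: vpart_fin_generated.
exact: vpart_projective (gp_fin_dim aQ Xf) Xp.
Qed.

Lemma pdle_vpart n X j : pdle n X -> pdle n (vpart j X).
Proof.
elim: n X => [|n IH] X /=; first by case; apply: vpart_fg_projective.
move=> [K [P [i [e [E Pf Pp /IH Kn]]]]].
have [Pjf Pjp] := vpart_fg_projective j Pf Pp.
exists (vpart j K), (vpart j P), (vmap i j), (vmap e j).
by split=> //; apply: vpart_short_exact.
Qed.

(** The kernel of a free cover is finitely generated because it is finite-dimensional over k. *)
Lemma gp_cover X : fin_generated X ->
  exists (K P : rmodType L) (i : {linear K -> P}) (e : {linear P -> X}),
    [/\ short_exact i e, fin_generated K, fin_generated P & projective P].
Proof.
move=> Xf; have [P [e [Pf Pp eS]]] := free_cover Xf.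
have E := ker_short_exact eS; have [iI _ _] := E.
exists (kermod e), P, (ker_incl e), e; split=> //.
apply: (restrict_fin_generated (phi := gp_scalars A)).
have li : linear (ker_incl e : restrict (gp_scalars A) (kermod e) ->
                  restrict (gp_scalars A) P).
  by apply: restrict_linear => a x y; rewrite linearP.
exact: fin_dim_inj li iI (gp_fin_dim aQ Pf).
Qed.

(** The bound starts at 1 because [submodule_projective] is applied to a syzygy, which embeds in a
    projective module. The parts of [K] are syzygies of the parts of [X], so the induction continues
    with [K]. *)
Lemma vpart_pdle n X : fin_generated X ->
  (forall j, pdle n.+1 (vpart j X)) -> pdle n.+1 X.
Proof.
elim: n X => [|n IH] X Xf Xn; have [K [P [i [e [E Kf Pf Pp]]]]] := gp_cover Xf;
  have Kn j : pdle _ (vpart j K) := pdle_syzygy (vpart_short_exact j E)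
    (vpart_fg_projective j Pf Pp).1 (vpart_fg_projective j Pf Pp).2 (Xn j);
  exists K, P, i, e; split=> //; last exact: IH.
split=> //; have [iI _ _] := E.
by apply: submodule_projective iI (gp_fin_dim aQ Pf) Pp _ => j; case: (Kn j).
Qed.

Lemma gp_pdle_iff n : (0 < #|arrow Q|)%N ->
  (forall X, fin_generated X -> pdle n X) <->
  (0 < n)%N /\ forall j (M : rmodType (A j)), fin_generated M -> pdle n M.
Proof.
move=> /card_gt0P [b _]; split=> [H|[n0 H] X Xf]; last first.
  case: n n0 H => // n _ H; apply: vpart_pdle => // j; apply: H.
  exact: vpart_fin_generated.
split=> [|j M Mf]; last first.
  exact/vpart_conc_pdle/pdle_vpart/H/conc_fin_generated.
(* The bound 0 is refuted by the regular module of [A (source b)], concentrated at its vertex. *)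
case: n H => // H; have := @conc_not_projective _ _ A b; case.
have [|//] := H (conc (((A (source b))^c)^o : rmodType (A (source b)))).
apply: conc_fin_generated; apply/fin_generatedP; exists 1%N, (fun=> 1) => x.
by exists (fun=> x); rewrite big_ord1 -[RHS]/(x * 1) mulr1.
Qed.

End GlobalDimension.

(** * Least elements and maxima *)

Lemma least_nat_unique (P : nat -> Prop) x y :
  least_nat P x -> least_nat P y -> x = y.
Proof.
move=> [[m [-> Pm mP]]|[-> nP]] [[n [-> Pn nP']]|[-> nP']] //.
- by have /eqP -> : m == n by rewrite eqn_leq mP ?nP'.
- by case: (nP' m).
- by case: (nP n).
Qed.

(** Two upward closed conditions hold together exactly from the larger of their thresholds on. *)
Lemma least_nat_max (P P' : nat -> Prop) x y :
  (forall m n, (m <= n)%N -> P m -> P n) ->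
  (forall m n, (m <= n)%N -> P' m -> P' n) ->
  least_nat P x -> least_nat P' y ->
  least_nat (fun n => P n /\ P' n) (maxe x y).
Proof.
move=> Pup Pup' [[m [-> Pm mP]]|[-> nP]]; last first.
  by move=> _; right; rewrite maxye; split=> // n [/nP].
move=> [[n [-> Pn nP]]|[-> nP]]; last first.
  by right; rewrite maxey; split=> // l [_ /nP].
left; exists (maxn m n); split=> [||l [/mP ml /nP nl]].
- have [mn|/ltnW nm] := leqP m n.
    by rewrite max_r // lee_fin lez_nat.
  by rewrite max_l // lee_fin lez_nat.
- by split; [apply: Pup Pm; apply: leq_maxl|apply: Pup' Pn; apply: leq_maxr].
- by rewrite geq_max ml nl.
Qed.

Lemma least_nat_bigmax (I : finType) (P : I -> nat -> Prop)
    (x : I -> \bar int) :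
  (forall i m n, (m <= n)%N -> P i m -> P i n) ->
  (forall i, least_nat (P i) (x i)) ->
  least_nat (fun n => (0 < n)%N /\ forall i, P i n) (\big[maxe/1%E]_i x i).
Proof.
move=> Pup Px.
(* Restricting the quantifier to members of a list allows induction along the big operator. *)
have -> : (fun n => (0 < n)%N /\ forall i, P i n)
    = (fun n => (0 < n)%N /\ forall i, i \in index_enum I -> P i n).
  apply/funext => n; apply/propext; split=> -[n0 Pn]; split=> // i.
  by apply: Pn; rewrite mem_index_enum.
elim: (index_enum I) => [|i s IH].
  (* The default value 1 of the maximum is the least [n] with [0 < n]. *)
  by rewrite big_nil; left; exists 1%N; split=> // m [].
rewrite big_cons.
have := least_nat_max (Pup i) _ (Px i) IH; rewrite (_ : (fun n => P i n /\ _)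
  = (fun n => (0 < n)%N /\ forall j, j \in i :: s -> P j n)).
  apply=> m n mn [m0 Pm]; split=> [|j js]; first exact: leq_trans m0 mn.
  exact/(Pup _ _ _ mn)/Pm.
apply/funext => n; apply/propext; split=> [[Pi [n0 Ps]]|[n0 Ps]].
  by split=> // j; rewrite inE => /predU1P [->|/Ps].
split; first by apply: Ps; rewrite mem_head.
by split=> // j js; apply: Ps; rewrite inE js orbT.
Qed.

Theorem theorem5p1 (k : closedFieldType) (Q : quiver)
    (A : vertex Q -> falgType k) :
  acyclic Q -> (0 < #|arrow Q|)%N -> (forall i, basic (A i)) ->
  gldim (gp_algebra A) = \big[maxe/1%E]_(j : vertex Q) gldim (A j).
Proof.
(* Both dimensions are the least natural number satisfying one condition, by [gp_pdle_iff], or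
   infinite together. *)
move=> aQ Q1 _; apply: least_nat_unique (gldim_leastn _) _.
have -> : (fun n => forall X : rmodType (gp_algebra A),
      fin_generated X -> pdle n X)
    = (fun n => (0 < n)%N /\
        forall j (M : rmodType (A j)), fin_generated M -> pdle n M).
  by apply/funext => n; apply/propext; exact: gp_pdle_iff.
apply: least_nat_bigmax => [j m n mn H M /H|j]; first exact: pdle_leq.
exact: gldim_leastn.
Qed.
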